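(* Let $u(t,x)$ be the solution of $$u_t(t,x)=\int_{\mathbf R}K(x,y)u(t,y)\,dy-b(x)u(t,x)+f(x,u(t,x)),\quad t>0,\ x\in\mathbf R,\qquad u(0,x)=u_0(x).$$ Then: 1) If (K1) and (K4) hold, then for all $\omega>\overline{\omega}$, $\displaystyle\lim_{t\to+\infty}\sup_{x\ge \omega t}|u(t,x)|=0$. 2) If (K1), (K2), (K3), (K4) and (K5) hold, then for all $0\le\omega<\underline{\omega}$, $\displaystyle\lim_{t\to+\infty}\sup_{0\le x\le \omega t}|u(t,x)-1|=0$. (The conditions (K1)–(K5) and the numbers $\underline\omega,\overline\omega$ are defined in the context.)
   Context: Setting. $K(x,y)\ge 0$ for all $(x,y)\in\mathbf R^2$; $K\phi(x):=\int_{\mathbf R}K(x,y)\phi(y)\,dy$; $b(x):=\int_{\mathbf R}K(x,y)\,dy$. The initial datum satisfies $u_0\in C(\mathbf R)$, $0\le u_0\le 1$, $u_0$ has compact support and $u_0(0)>0$. The reaction term $f:\mathbf R\times[0,1]\to\mathbf R$ satisfies $f(x,0)\equiv f(x,1)\equiv 0$; $0<\inf_{x\in\mathbf R}f(x,s)\le f(x,s)\le f_s'(x,0)s$ for all $s\in(0,1)$; $f_s'(\cdot,0)\in C(\mathbf R)$; and $\sup_{x\in\mathbf R}\|f(x,\cdot)\|_{\mathcal C^{1+\gamma}([0,1])}<+\infty$ for some $\gamma>0$. Put $a(x):=b(x)-f_s'(x,0)$. The solution $u$ is the unique one given by semigroup theory in the spaces $X_z=\{\phi\in C(\mathbf R):\sup_x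 e^{-|x-z|}|\phi(x)|<\infty\}$; it satisfies $0\le u\le 1$. Conditions. (K1) $K$ maps $C(\mathbf R)$ to $C(\mathbf R)$, and $x\mapsto\int_{\mathbf R}K(x,x-\xi)e^{-p\xi}\,d\xi$ belongs to $L^\infty(\mathbf R)\cap C(\mathbf R)$ for every $p\in\mathbf R$. (K2) For every fixed $p\in\mathbf R$ and every $\sigma>0$ there is $R>0$ with $\sup_{x\in\mathbf R}\int_{|\xi|\ge R}K(x,x-\xi)e^{-p\xi}\,d\xi<\sigma$. (K3) There exist $\delta_0>0$, $\eta_0>0$ and a constant $C>0$ (depending on $\delta_0,\eta_0$) such that $K[\phi\chi_{\eta+\delta_0}](x)\ge C\min_{|y|\le\eta}\phi(y)$ for all $\eta\ge\eta_0$, all $|x|\le\eta+\delta_0$ and all $\phi\in C(\mathbf R)$ with $\phi\ge0$, where $\chi_r(x)=1$ if $|x|\le r$ and $\chi_r(x)=0$ if $|x|>r$. (K4) $k(p):=\liminf_{R\to\infty}\inf_{|x|\ge R}\{\int_{\mathbf R}K(x,x-\xi)e^{-p\xi}\,d\xi-b(x)+f_s'(x,0)\}>0$ for all $p\in\mathbf R$, and $\lim_{p\to+\infty}k(\pm p)/p=\lim_{p\to0^+}k(\pm p)/p=+\infty$. (K5) $e^{Kt}u_0(x)=\sum_{n=0}^\infty \frac{t^nK^nu_0(x)}{n!}>0$ for all $x\in\mathbf R$, $t>0$. Generalized principal eigenvalues. For $p\in\mathbf R$ let $L_p\phi(x)=\int_{\mathbf R}K(x,y)e^{p(y-x)}\phi(y)\,dy-a(x)\phi(x)$.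 Let $\mathcal A$ be the set of uniformly continuous $\phi\in C(\mathbf R)$ with $0<\inf_{\mathbf R}\phi\le\sup_{\mathbf R}\phi<+\infty$. For $R\in\{-\infty\}\cup\mathbf R$ let $I_R=(R,+\infty)$ and $\underline{\lambda_1}(p,R)=\sup\{\lambda:\exists\phi\in\mathcal A,\ L_p\phi\ge\lambda\phi\text{ on }I_R\}$, $\overline{\lambda_1}(p,R)=\inf\{\lambda:\exists\phi\in\mathcal A,\ L_p\phi\le\lambda\phi\text{ on }I_R\}$ (with $\sup\emptyset=-\infty$, $\inf\emptyset=+\infty$). These are respectively nondecreasing and nonincreasing in $R$; set $\underline H(p)=\lim_{R\to+\infty}\underline{\lambda_1}(p,R)$, $\overline H(p)=\lim_{R\to+\infty}\overline{\lambda_1}(p,R)$, and $$\underline\omega=\min_{p>0}\frac{\underline H(-p)}{p},\qquad \overline\omega=\min_{p>0}\frac{\overline H(-p)}{p}.$$ *)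

(* Defs.v *)
From mathcomp Require Import all_boot all_order all_algebra.
From mathcomp Require Import all_classical all_reals all_analysis.

Set Implicit Arguments.
Unset Strict Implicit.
Unset Printing Implicit Defensive.

Import Order.TTheory GRing.Theory Num.Theory.
Import numFieldNormedType.Exports.

Local Open Scope classical_set_scope.
Local Open Scope ring_scope.

Section Data.
Variable R : realType.
Implicit Types (K f : R -> R -> R) (phi g : R -> R) (u : R -> R -> R).

Local Notation mu := (@lebesgue_measure R).

(* Measurability of the slices is what makes the integrals against K(x, .)
   meaningful; no joint regularity is required. *)
Definition dispersal_kernel K : Prop :=
  (forall x y, 0 <= K x y) /\ (forall x, measurable_fun setT (K x)).

Definition Kop K phi (x : R) : R := \int[mu]_(y in setT) (K x y * phi y).

Definition bcoef K (x : R) : R := \int[mu]_(y in setT) K x y.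

(* Exponential moment over a set D of displacements xi, in [0, +oo]. *)
Definition emoment_on K (D : set R) (p x : R) : \bar R :=
  (\int[mu]_(xi in D) (K x (x - xi) * expR (- (p * xi)))%:E)%E.

Definition moment K (p x : R) : R := fine (emoment_on K setT p x).

Definition initial_datum (u0 : R -> R) : Prop :=
  [/\ continuous u0, (forall x, 0 <= u0 x <= 1),
      compact (closure [set x | u0 x != 0]) & 0 < u0 0].

(* Derivatives on [0, 1] are taken within [0, 1], hence one-sided at 0 and 1:
   the reaction term is only meaningful for values of s in [0, 1]. *)
Definition diffquot01 g (s t : R) : R := (g t - g s) / (t - s).

Definition derivable01 g : Prop :=
  forall s, s \in `[0, 1] -> cvg (diffquot01 g s @ within `[0, 1] s^').

Definition deriv01 g (s : R) : R := lim (diffquot01 g s @ within `[0, 1] s^').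

(* The C^{1+gamma}([0, 1]) norm, for 0 < gamma <= 1. *)
Definition C1holder_norm (gamma : R) g : \bar R :=
  (ereal_sup [set `|g s|%:E | s in `[0%R, 1%R]]
   + ereal_sup [set `|deriv01 g s|%:E | s in `[0%R, 1%R]]
   + ereal_sup [set (`|deriv01 g st.1 - deriv01 g st.2|
                       / (`|st.1 - st.2| `^ gamma))%:E |
                st in [set st : R * R | [/\ st.1 \in `[0%R, 1%R],
                         st.2 \in `[0%R, 1%R] & st.1 != st.2]]])%E.

(* f_s'(x, 0). *)
Definition fs0 f (x : R) : R := deriv01 (f x) 0.

(* "For some gamma > 0" is read with 0 < gamma <= 1: on [0, 1] a bound in
   C^{1+gamma} for a larger exponent implies one for every smaller exponent. *)
Definition reaction f : Prop :=
  [/\ (forall x, f x 0 = 0 /\ f x 1 = 0),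
      (forall s, 0 < s < 1 ->
         (0 < ereal_inf [set (f x s)%:E | x in setT])%E /\
         (forall x, f x s <= fs0 f x * s)),
      continuous (fs0 f) &
      (forall x, derivable01 (f x)) /\
      exists gamma : R, 0 < gamma <= 1 /\
        (ereal_sup [set C1holder_norm gamma (f x) | x in setT] < +oo)%E].

Definition acoef K f (x : R) : R := bcoef K x - fs0 f x.

Definition Xnorm (z : R) phi : \bar R :=
  ereal_sup [set (expR (- `|x - z|) * `|phi x|)%:E | x in setT].

Definition Xspace (z : R) phi : Prop :=
  continuous phi /\ (Xnorm z phi < +oo)%E.

Definition rhs K f phi (x : R) : R :=
  Kop K phi x - bcoef K x * phi x + f x (phi x).

(* Since the linear part is bounded on X_z, the solution given by semigroup
   theory is the classical one: u is continuous from [0, +oo) to X_z and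
   differentiable in the norm of X_z for t > 0, for every z. *)
Definition solution K f (u0 : R -> R) u : Prop :=
  [/\ u 0 = u0,
      (forall t, 0 <= t -> forall x, 0 <= u t x <= 1) &
      forall z,
      [/\ (forall t, 0 <= t -> Xspace z (u t)),
          (forall t, 0 <= t ->
             Xnorm z (fun x => u s x - u t x)
               @[s --> within [set s | 0 <= s] (nbhs t)] --> 0%E) &
          (forall t, 0 < t ->
             Xnorm z (fun x => (u s x - u t x) / (s - t) - rhs K f (u t) x)
               @[s --> t^'] --> 0%E)]].

(* A continuous function may grow too fast for K(x, .) phi to be integrable
   (e.g. for Gaussian kernels), so "K maps C(R) to C(R)" is read on the phi in
   C(R) for which K phi is defined everywhere; these include all bounded phi
   and all phi in the spaces X_z. *)
Definition cond_K1 K : Prop :=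
  (forall phi, continuous phi ->
     (forall x, mu.-integrable setT (fun y => (K x y * phi y)%:E)) ->
     continuous (Kop K phi)) /\
  (forall p : R,
     (exists M : R, forall x, (emoment_on K setT p x <= M%:E)%E) /\
     continuous (moment K p)).

Definition cond_K2 K : Prop :=
  forall p sigma : R, 0 < sigma -> exists2 r : R, 0 < r &
    (ereal_sup [set emoment_on K [set xi | (r <= `|xi|)%R] p x | x in setT]
       < sigma%:E)%E.

Definition cutoff (r x : R) : R := if `|x| <= r then 1 else 0.

(* The infimum over the compact interval is the minimum. *)
Definition cond_K3 K : Prop :=
  exists delta0 eta0 C : R, [/\ 0 < delta0, 0 < eta0, 0 < C &
    forall eta x phi, eta0 <= eta -> `|x| <= eta + delta0 ->
      continuous phi -> (forall y, 0 <= phi y) ->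
      C * inf [set phi y | y in [set y | `|y| <= eta]]
        <= Kop K (fun y => phi y * cutoff (eta + delta0) y) x].

Definition kfun K f (p : R) : \bar R :=
  limf_einf (fun r : R =>
    ereal_inf [set (moment K p x - bcoef K x + fs0 f x)%:E |
               x in [set x | r <= `|x|]]) +oo.

Definition cond_K4 K f : Prop :=
  (forall p, (0 < kfun K f p)%E) /\
  [/\ (kfun K f p * (p^-1)%:E)%E @[p --> +oo] --> +oo%E,
      (kfun K f (- p) * (p^-1)%:E)%E @[p --> +oo] --> +oo%E,
      (kfun K f p * (p^-1)%:E)%E @[p --> 0^'+] --> +oo%E &
      (kfun K f (- p) * (p^-1)%:E)%E @[p --> 0^'+] --> +oo%E].

Definition cond_K5 K (u0 : R -> R) : Prop :=
  forall x t : R, 0 < t ->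
    (0 < \sum_(0 <= n <oo) (t ^+ n * iter n (Kop K) u0 x / n`!%:R)%:E)%E.

Definition Lop K f (p : R) phi (x : R) : R :=
  \int[mu]_(y in setT) (K x y * expR (p * (y - x)) * phi y)
  - acoef K f x * phi x.

Definition test_function phi : Prop :=
  unif_continuous phi /\
  exists m M : R, 0 < m /\ forall x, m <= phi x <= M.

(* r ranges over R together with -oo. *)
Definition I_ (r : \bar R) : set R := [set x | (r < x%:E)%E].

Definition lambda1_lower K f (p : R) (r : \bar R) : \bar R :=
  ereal_sup [set l%:E | l in [set l : R | exists2 phi, test_function phi &
    forall x, I_ r x -> l * phi x <= Lop K f p phi x]].

Definition lambda1_upper K f (p : R) (r : \bar R) : \bar R :=
  ereal_inf [set l%:E | l in [set l : R | exists2 phi, test_function phi &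
    forall x, I_ r x -> Lop K f p phi x <= l * phi x]].

Definition H_lower K f (p : R) : \bar R :=
  lim (lambda1_lower K f p r%:E @[r --> (+oo)%R]).

Definition H_upper K f (p : R) : \bar R :=
  lim (lambda1_upper K f p r%:E @[r --> (+oo)%R]).

(* The infimum coincides with the minimum over p > 0 when it is attained. *)
Definition omega_lower K f : \bar R :=
  ereal_inf [set (H_lower K f (- p) * (p^-1)%:E)%E | p in [set p | 0 < p]].

Definition omega_upper K f : \bar R :=
  ereal_inf [set (H_upper K f (- p) * (p^-1)%:E)%E | p in [set p | 0 < p]].

End Data.

(* Main.v *)
Require Import Defs.
From mathcomp Require Import all_boot all_order all_algebra.
From mathcomp Require Import all_classical all_reals all_analysis.
From mathcomp Require Import measurable_realfun ring lra.

(* A positive supersolution [expR (l * t - p * x) * phi x], built on a test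
   function with [L_(-p) phi <= l * phi] far to the right, dominates [u] and
   travels at the speed [l / p]; that [l > 0] follows from (K4) by looking at
   points where [phi] is close to its lower limit at [+oo]. This gives the upper
   bound.

   For the lower bound, (K3) and (K5) show that at times of order [L] the
   solution is at least [expR (- C * L)] on [`|x| <= S * L]. Above this level,
   [ln u] is compared, on the scale [L], with explicit concave profiles [chi]
   whose time derivative is smaller than the eigenvalue attached to their slope.
   If [chi] touched [ln u] from below, then near the contact point a Gaussian
   multiple of the exponential [expR (sigma * x) * phi x], where [phi] is the test
   function for the slope [sigma] at the contact point, would be a subsolution
   lying above [u] at that point although it is below [u] around it: only one
   slope is involved at a time, so the test functions for different slopes need
   not be related. A stationary profile (with [phi = 1], using (K4)) first
   gives a linear invasion at some positive speed; a profile moving at any speed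
   below [omega_lower] then gives invasion at that speed, all slopes of the
   front being admissible because [w * q] is less than the eigenvalue at [- q]
   for every [q >= 0]. Finally the positivity of [f] drives [u] to [1] behind
   the front. *)

Set Implicit Arguments.
Unset Strict Implicit.
Unset Printing Implicit Defensive.

Import Order.TTheory GRing.Theory Num.Theory.
Import numFieldNormedType.Exports.

Local Open Scope classical_set_scope.
Local Open Scope ring_scope.

(** The scale [L] is what makes the profiles usable. The a priori level of [u] is exponentially
    small in [L], so a profile may descend to it over a length [L] with slopes bounded independently
    of [L], while its curvature is of order [1 / L]. In a box of fixed size [r] the profile is then
    affine up to a quadratic error that vanishes as [L] grows, and the only function to be tested
    against the equation is one exponential times one test function. This dictates the order of
    choices: the eigenvalue gap [delta], the oscillation [C] of the test functions and the bound [Q]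
    on the slopes give the size [r] of the box and the admissible curvature [eta]; only then is [L]
    taken large. The delicate point is [Q]: it comes from the depth of the profile, hence from the
    duration of the invasion, hence from [delta]. So [delta] must be known before [Q], which is why
    a gap independent of the slope is extracted from (K4) for the first invasion. In the second one
    the duration is prescribed, and the gap may depend on [Q]. *)

Section derivatives.
Variable R : realType.
Implicit Types (f g : R -> R) (x a b : R).

Lemma is_deriveD1 f g x a b : is_derive x 1 f a -> is_derive x 1 g b ->
  is_derive x 1 (fun s => f s + g s) (a + b).
Proof. by move=> fa gb; exact: is_deriveD. Qed.

Lemma is_deriveB1 f g x a b : is_derive x 1 f a -> is_derive x 1 g b ->
  is_derive x 1 (fun s => f s - g s) (a - b).
Proof. by move=> fa gb; exact: is_deriveB. Qed.

Lemma is_deriveM1 f g x a b : is_derive x 1 f a -> is_derive x 1 g b ->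
  is_derive x 1 (fun s => f s * g s) (a * g x + f x * b).
Proof.
move=> fa gb; have h := is_deriveM fa gb.
by apply: (is_derive_eq h); rewrite /GRing.scale/= addrC mulrC.
Qed.

Lemma is_deriveZ1 f k x a : is_derive x 1 f a ->
  is_derive x 1 (fun s => k * f s) (k * a).
Proof. by move=> fa; exact: is_deriveZ. Qed.

Lemma is_derive_expR1 f x a : is_derive x 1 f a ->
  is_derive x 1 (fun s => expR (f s)) (a * expR (f x)).
Proof.
move=> fa; rewrite mulrC.
exact: (@is_derive1_comp _ expR f _ _ _ (is_derive_expR _) fa).
Qed.

Lemma is_derive_aff (k c x : R) : is_derive x 1 (fun s => k * (s - c)) k.
Proof.
have h : is_derive x 1 (fun s : R => s - c) (1 - 0).
  by apply: is_deriveB1.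
by rewrite -[X in is_derive _ _ _ X]mulr1 -[X in _ * X]subr0; exact: is_deriveZ1.
Qed.

Lemma is_derive_continuous f x a : is_derive x 1 f a -> {for x, continuous f}.
Proof. by move=> [fx _]; apply/differentiable_continuous/derivable1_diffP. Qed.

End derivatives.

(** The sign of the derivative is known only where [g] is positive. If [g t > 0], continuity
    provides a last time [z < t] with [g z <= 0], and the mean value theorem between [z] and [t]
    contradicts the increase. *)
Lemma le0_of_derive_le0 (R : realType) (g dg : R -> R) (a b : R) :
  {within `[a, b], continuous g} ->
  (forall t, a < t < b -> is_derive t 1 g (dg t)) ->
  g a <= 0 ->
  (forall t, a < t < b -> 0 < g t -> dg t <= 0) ->
  forall t, a <= t <= b -> g t <= 0.
Proof.
move=> cg dgP ga dg0 t /andP[at_ tb]; rewrite leNgt; apply/negP => gt0.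
have cgt c d : a <= c -> d <= b -> {within `[c, d], continuous g}.
  move=> ac db; apply: continuous_subspaceW cg => x /=.
  by rewrite !in_itv/= => /andP[cx xd]; rewrite (le_trans ac)//= (le_trans xd).
pose S := [set s | a <= s <= t /\ g s <= 0].
have Sa : S a by split=> //; rewrite lexx.
have ubS : ubound S t by move=> s [/andP[]].
have hS : has_sup S by split; [exists a|exists t].
pose z := sup S.
have az : a <= z by apply: ub_le_sup => //; exists t.
have zt : z <= t by apply: ge_sup => //; exists a.
have gz : g z <= 0.
  have czS : closure S z by case: hS => ? ?; exact: closure_sup.
  have Ssub : S `<=` `[a, b] `&` g @^-1` [set x | x <= 0].
    move=> s [/andP[as_ st] gs0]; split => //=.
    by rewrite in_itv/= as_ (le_trans st tb).
  have clS : closed (`[a, b] `&` g @^-1` [set x | x <= 0]).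
    rewrite setIC closed_setIS; last exact: itv_closed.
    by move: cg => /continuous_closedP; apply; exact: closed_le.
  move: czS => /(closure_subset Ssub).
  by rewrite -(closure_id _).1//; case.
have zltt : z < t by rewrite lt_neqAle zt andbT; apply: contraTneq gt0 => <-; rewrite -leNgt.
have gpos s : z < s -> s <= t -> 0 < g s.
  move=> zs st; rewrite ltNge; apply/negP => gs; suff : s <= z by rewrite leNgt zs.
  apply: ub_le_sup; first by exists t.
  by split=> //; rewrite st (le_trans az (ltW zs)).
have dgzt x : x \in `]z, t[ -> is_derive x 1 g (dg x).
  rewrite in_itv/= => /andP[zx xt]; apply: dgP.
  by rewrite (le_lt_trans az zx) (lt_le_trans xt tb).
have [c] := MVT zltt dgzt (cgt _ _ az tb).
rewrite in_itv/= => /andP[zc ct] E.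
have : dg c * (t - z) <= 0.
  apply: mulr_le0_ge0; last by rewrite subr_ge0.
  apply: dg0; last exact: gpos (ltW ct).
  by rewrite (le_lt_trans az zc) (lt_le_trans ct tb).
rewrite -E; lra.
Qed.

(* Weighting by [expR (- (2 * C + 1) * t)] halves the supremum of the positive
   part of [w], which is therefore zero. *)
Lemma comparison (R : realType) (w dw : R -> R -> R) (a b C W : R) :
  0 <= C ->
  (forall x, {within `[a, b], continuous (w^~ x)}) ->
  (forall t x, a < t < b -> is_derive t 1 (w^~ x) (dw t x)) ->
  (forall x, w a x <= 0) ->
  (forall t x, a <= t <= b -> w t x <= W) ->
  (forall t N, a < t < b -> 0 <= N -> (forall y, w t y <= N) ->
    forall x, 0 < w t x -> dw t x <= C * N) ->
  forall t x, a <= t <= b -> w t x <= 0.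
Proof.
move=> C0 cw dwP wa wW dwle.
pose L := C *+ 2 + 1.
have L0 : 0 <= L by rewrite /L addr_ge0// mulrn_wge0.
pose S := [set y | y = 0 \/ exists t x, a <= t <= b /\ y = expR (- (L * (t - a))) * w t x].
have S0 : S 0 by left.
have ubS : has_ubound S.
  exists (Num.max 0 W) => y [->|[t [x [atb ->]]]]; first by rewrite le_max lexx.
  have [w0|w0] := leP (w t x) 0.
    by rewrite le_max (mulr_ge0_le0 _ w0)// expR_ge0.
  rewrite le_max; apply/orP; right.
  rewrite (le_trans _ (wW t x atb))// ler_piMl ?(ltW w0)// -expR0 ler_expR oppr_le0.
  by case/andP: atb => ? ?; rewrite mulr_ge0// subr_ge0.
pose N := sup S.
have N0 : 0 <= N by exact: ub_le_sup.
have wN t y : a <= t <= b -> w t y <= N * expR (L * (t - a)).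
  move=> atb; rewrite -ler_pdivrMr ?expR_gt0// -expRN mulrC.
  by apply: ub_le_sup => //; right; exists t, y.
have wN2 t x : a <= t <= b -> w t x <= N / 2 * expR (L * (t - a)).
  move=> atb; rewrite -subr_le0.
  pose g s := w s x - N / 2 * expR (L * (s - a)).
  pose dg s := dw s x - N / 2 * (L * expR (L * (s - a))).
  have dE (s : R) : is_derive s 1 (fun s => N / 2 * expR (L * (s - a))) (N / 2 * (L * expR (L * (s - a)))).
    exact/is_deriveZ1/is_derive_expR1/is_derive_aff.
  apply: (@le0_of_derive_le0 _ g dg a b) => //.
  - have cE : continuous (fun s : R => N / 2 * expR (L * (s - a))).
      by move=> s; exact: is_derive_continuous (dE s).
    by move=> s; apply: cvgB; [exact: cw|exact: continuous_subspaceT cE s].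
  - by move=> s asb; apply: is_deriveB1 => //; exact: dwP.
  - have := wa x; rewrite /g subrr mulr0 expR0 mulr1; move: N0; lra.
  - move=> s asb gs; rewrite /dg.
    have ws : 0 < w s x.
      rewrite (lt_le_trans gs)// /g lerBlDr lerDl mulr_ge0 ?expR_ge0// divr_ge0//.
    have asb' : a <= s <= b by case/andP: asb => /ltW-> /ltW->.
    (* The supremum in [x] over the line need not be attained; only the bound
       [N * expR (L * (s - a))], valid at all points, enters, and this is also all that a nonlocal
       term can see. *)
    have := dwle s _ asb _ (fun y => wN s y asb') _ ws.
    rewrite mulr_ge0 ?expR_ge0// => /(_ isT).
    move: (expR_gt0 (L * (s - a))) => E0; rewrite /L.
    set E := expR _ in E0 *; have : 0 <= N * E by rewrite mulr_ge0// ltW.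
    by move=> ? ?; nra.
have N2 : N <= N / 2.
  apply: ge_sup; first by exists 0.
  move=> y [->|[t [x [atb ->]]]]; first by rewrite divr_ge0.
  rewrite mulrC expRN ler_pdivrMr ?expR_gt0//.
  exact: wN2.
have N00 : N = 0 by move: N0 N2; lra.
by move=> t x atb; have := wN t x atb; rewrite N00 mul0r.
Qed.

(** * Reflection invariance of the Lebesgue measure *)

Section reflection.
Variable R : realType.
Local Notation mu := (@lebesgue_measure R).

Lemma measurable_subl (x : R) : measurable_fun setT (fun y : R => x - y).
Proof. by apply: measurable_funB => //; exact: measurable_cst. Qed.

Lemma lebesgue_measure_subl (x : R) (A : set R) : measurable A ->
  mu A = pushforward mu (fun y => x - y : measurableTypeR R) A.
Proof.
move=> mA; apply: lebesgue_measure_unique => //=; first exact: measurable_subl.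
move=> mx _ [[a b] _ <-] /=.
rewrite /pushforward/=.
have -> : (fun y : R => x - y) @^-1` `]a, b] = `[x - b, x - a[%classic.
  apply/seteqP; split=> y /=; rewrite !in_itv/= => /andP[? ?]; apply/andP; split; lra.
rewrite !lebesgue_measure_itv/= !lte_fin ltrD2l ltrN2.
by case: ifP => // _; rewrite -!EFinB; congr EFin; ring.
Qed.

Lemma ge0_integral_subl (x : R) (G : R -> \bar R) :
  measurable_fun [set: R] G -> (forall y, 0 <= G y)%E ->
  (\int[mu]_y G (x - y)%R = \int[mu]_y G y)%E.
Proof.
move=> mG G0.
have mx := measurable_subl x.
have := @ge0_integral_pushforward _ _ (measurableTypeR R) (measurableTypeR R) R
  (fun y => x - y) mx mu setT G measurableT mG (fun y _ => G0 y).
rewrite preimage_setT /comp => <-.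
apply: eq_measure_integral => A mA _.
exact/esym/lebesgue_measure_subl.
Qed.

End reflection.

(** * Integrals against the kernel and exponential moments *)

Section kernel.
Variables (R : realType) (K : R -> R -> R).
Hypothesis hK : dispersal_kernel K.
Implicit Types (x y p q c : R) (g h phi : R -> R).
Local Notation mu := (@lebesgue_measure R).

(** [Kop] is a real-valued integral, meaningful only under integrability; this predicate is carried
    along so that linearity and monotonicity of [Kop] may be used. *)
Definition Kint (x : R) (g : R -> R) : Prop :=
  mu.-integrable setT (fun y => (K x y * g y)%:E).

Lemma K_ge0 x y : 0 <= K x y. Proof. by case: hK. Qed.

Lemma measurable_K x : measurable_fun setT (K x). Proof. by case: hK. Qed.

Lemma Kint_dom x g h : measurable_fun [set: R] g -> (forall y, `|g y| <= h y) ->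
  Kint x h -> Kint x g.
Proof.
move=> mg gh ih; apply: (le_integrable _ _ _ ih) => //.
  by apply/measurable_EFinP; apply: measurable_funM => //; exact: measurable_K.
move=> y _; rewrite !lee_fin !normrM ler_wpM2l//.
by rewrite (le_trans (gh y))// ler_norm.
Qed.

Lemma KintD x g h : Kint x g -> Kint x h -> Kint x (fun y => g y + h y).
Proof.
move=> ig ih; have := integrableD measurableT ig ih.
by apply: eq_integrable => // y _; rewrite -EFinD -mulrDr.
Qed.

Lemma KintZ x c g : Kint x g -> Kint x (fun y => c * g y).
Proof.
move=> ig; have := integrableZl measurableT c ig.
by apply: eq_integrable => // y _; rewrite -EFinM mulrCA.
Qed.

Lemma KopD x g h : Kint x g -> Kint x h ->
  Kop K (fun y => g y + h y) x = Kop K g x + Kop K h x.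
Proof.
move=> ig ih; rewrite /Kop -RintegralD//.
by apply: eq_Rintegral => y _; rewrite mulrDr.
Qed.

Lemma KopZ x c g : Kint x g -> Kop K (fun y => c * g y) x = c * Kop K g x.
Proof.
move=> ig; rewrite /Kop -RintegralZl//.
by apply: eq_Rintegral => y _; rewrite mulrCA.
Qed.

Lemma Kop_le x g h : Kint x g -> Kint x h -> (forall y, g y <= h y) ->
  Kop K g x <= Kop K h x.
Proof.
move=> ig ih gh; apply: le_Rintegral => // y _.
by rewrite ler_wpM2l// K_ge0.
Qed.

Lemma Kop_ge0 x g : (forall y, 0 <= g y) -> 0 <= Kop K g x.
Proof. by move=> g0; apply: Rintegral_ge0 => y _; rewrite mulr_ge0// K_ge0. Qed.

Lemma emomentE p x : emoment_on K setT p x =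
  (\int[mu]_y (K x y * expR (p * (y - x)))%:E)%E.
Proof.
rewrite -(@ge0_integral_subl _ x).
- rewrite /emoment_on; apply: eq_integral => y _.
  by congr (_ * expR _)%:E; ring.
- apply/measurable_EFinP; apply: measurable_funM; first exact: measurable_K.
  by apply: continuous_measurable_fun => y; apply: is_derive_continuous (is_derive_expR1 (is_derive_aff _ _ _)).
- by move=> y; rewrite lee_fin mulr_ge0 ?K_ge0// expR_ge0.
Qed.

Lemma momentE p x : moment K p x = Kop K (fun y => expR (p * (y - x))) x.
Proof. by rewrite /moment emomentE. Qed.

Lemma bcoefE x : bcoef K x = Kop K (fun=> 1) x.
Proof. by rewrite /bcoef /Kop; apply: eq_Rintegral => y _; rewrite mulr1. Qed.

Lemma LopE f p phi x : Lop K f p phi x =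
  Kop K (fun y => expR (p * (y - x)) * phi y) x - acoef K f x * phi x.
Proof. by rewrite /Lop /Kop; congr (_ - _); apply: eq_Rintegral => y _; rewrite mulrA. Qed.

Hypothesis hM : forall p : R, exists M : R, forall x, (emoment_on K setT p x <= M%:E)%E.

Lemma Kint_expR p x : Kint x (fun y => expR (p * (y - x))).
Proof.
apply/integrableP; split.
  apply/measurable_EFinP; apply: measurable_funM; first exact: measurable_K.
  by apply: continuous_measurable_fun => y; apply: is_derive_continuous (is_derive_expR1 (is_derive_aff _ _ _)).
have [M /(_ x)] := hM p; rewrite emomentE => h.
under eq_integral do rewrite gee0_abs ?lee_fin ?mulr_ge0 ?K_ge0 ?expR_ge0//.
by rewrite (le_lt_trans h)// ltry.
Qed.

Lemma expR_norm_le (q z : R) : expR (q * `|z|) <= expR (q * z) + expR (- q * z).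
Proof.
have [z0|z0] := leP 0 z; first by rewrite ger0_norm// lerDl expR_ge0.
by rewrite ltr0_norm// mulrN -mulNr lerDr expR_ge0.
Qed.

Lemma continuous_expR_norm q x : continuous (fun y : R => expR (q * `|y - x|)).
Proof.
move=> y; apply: continuous_comp; last exact: continuous_expR.
apply: cvgM; first exact: cvg_cst.
by apply: cvg_norm; apply: cvgB; [exact: cvg_id|exact: cvg_cst].
Qed.

Lemma Kint_expR_norm q x : Kint x (fun y => expR (q * `|y - x|)).
Proof.
apply: Kint_dom (KintD (Kint_expR q x) (Kint_expR (- q) x)).
  by apply: continuous_measurable_fun; exact: continuous_expR_norm.
by move=> y; rewrite ger0_norm ?expR_ge0// expR_norm_le.
Qed.

(** The error terms of the later estimates (truncation, tilting, change of exponent, slope of a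
    cone) are dominated by such a two-sided exponential, uniformly in [x]. *)
Lemma Kop_expR_norm_le q : exists2 M, 0 < M & forall x,
  Kop K (fun y => expR (q * `|y - x|)) x <= M.
Proof.
have [M1 h1] := hM q; have [M2 h2] := hM (- q).
exists (`|M1| + `|M2| + 1); first by rewrite ltr_wpDl// addr_ge0.
have mE p M x : (emoment_on K setT p x <= M%:E)%E ->
    Kop K (fun y => expR (p * (y - x))) x <= `|M|.
  move=> h; rewrite -momentE /moment (le_trans _ (ler_norm M))//.
  have fin : emoment_on K setT p x \is a fin_num.
    rewrite ge0_fin_numE; first by rewrite (le_lt_trans h)// ltry.
    by apply: integral_ge0 => y _; rewrite lee_fin mulr_ge0 ?K_ge0// expR_ge0.
  by rewrite -lee_fin fineK.
move=> x; rewrite (le_trans (Kop_le (Kint_expR_norm q x) (KintD (Kint_expR q x) (Kint_expR (- q) x)) _))//.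
  by move=> y; exact: expR_norm_le.
rewrite KopD; try exact: Kint_expR.
by rewrite (le_trans (lerD (mE _ _ _ (h1 x)) (mE _ _ _ (h2 x))))// lerDl.
Qed.

End kernel.

(** Compactness of the segment in its near-covering form. The parameter [i] stands for a threshold
    whose inverse also serves as a positive gap, so that one number records every constant to be
    made uniform. *)
Lemma itv_compact_uniform (R : realType) (a b : R) (P : R -> R -> Prop) :
  (forall s, a <= s <= b -> exists r n : R, 0 < r /\
     forall s' i, `|s' - s| < r -> n <= i -> P i s') ->
  exists n, forall i s, n <= i -> a <= s <= b -> P i s.
Proof.
move=> H.
have /(_ R +oo P _) h : near_covering `[a, b].
  by apply/compact_near_coveringP; exact: segment_compact.
have [s|T [Tr TP]] := h _.
  rewrite /= in_itv/= => sab; have [r [n [r0 rP]]] := H s sab.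
  exists ([set s' | `|s' - s| < r], [set i | n <= i]) => /=.
    split; first by exists r => //= s'; rewrite /ball_/= distrC.
    by apply: nbhs_pinfty_ge; rewrite num_real.
  by move=> [s' i] [/=]; exact: rP.
exists (T + 1) => i s Ti sab; apply: (TP i) => /=; last by rewrite in_itv.
by rewrite (lt_le_trans _ Ti)// ltrDl.
Qed.

Lemma is_derive_eps (R : realType) (g : R -> R) (x d : R) :
  (forall e, 0 < e -> exists2 r, 0 < r & forall t, 0 < `|t - x| < r ->
     `|(g t - g x) / (t - x) - d| < e) ->
  is_derive x 1 g d.
Proof.
move=> H.
suff cv : h^-1 *: ((g \o shift x) (h *: (1 : R)) - g x) @[h --> 0^'] --> d.
  apply: DeriveDef; last exact/cvg_lim.
  by apply/cvg_ex; exists d.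
apply/cvgrPdist_lt => e e0; have [r r0 rP] := H e e0.
rewrite near_withinE; exists r => //= h /=; rewrite sub0r normrN => hr h0.
have := rP (h + x); rewrite addrK normr_gt0 h0 hr => /(_ isT).
by rewrite distrC /= /GRing.scale/= mulr1 [h^-1 * _]mulrC.
Qed.

(** * Bounds on the reaction term that are uniform in space *)

Section reaction.
Variables (R : realType) (f : R -> R -> R).
Hypothesis hf : reaction f.
Implicit Types (a b c d e s t x : R) (g : R -> R).

Lemma deriv01_eps (g : R -> R) : derivable01 g -> forall s, 0 <= s <= 1 ->
  forall e, 0 < e -> exists2 r, 0 < r & forall t, 0 <= t <= 1 -> 0 < `|t - s| < r ->
     `|(g t - g s) / (t - s) - deriv01 g s| < e.
Proof.
move=> dg s s01 e e0.
have sin : s \in `[0, 1] by rewrite in_itv.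
have : diffquot01 g s @ within `[0, 1] s^' --> deriv01 g s := dg s sin.
move=> /cvgrPdist_lt/(_ e e0); rewrite near_withinE near_withinE => -[r /= r0 rP].
exists r => // t t01 /andP[ts tr]; rewrite distrC.
apply: (rP t); [by rewrite /= distrC|by rewrite -subr_eq0 -normr_gt0|].
by rewrite /= in_itv.
Qed.

Lemma derivable01_continuous (g : R -> R) : derivable01 g ->
  {within `[0, 1], continuous g}.
Proof.
move=> dg; apply/subspace_continuousP => s; rewrite /= in_itv/= => s01.
have [r r0 rP] := deriv01_eps dg s01 ltr01.
apply/cvgrPdist_lt => e e0.
pose k := `|deriv01 g s| + 1.
have k0 : 0 < k by rewrite ltr_wpDl.
rewrite near_withinE; exists (Num.min r (e / k)) => /=.
  by rewrite lt_min r0 divr_gt0.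
move=> t /=; rewrite lt_min => /andP[tr te]; rewrite in_itv/= => t01.
have [->|ts] := eqVneq t s; first by rewrite subrr normr0.
have ts0 : 0 < `|t - s| by rewrite normr_gt0 subr_eq0.
have := rP t t01; rewrite ts0 distrC tr => /(_ isT) h.
have h2 : `|(g t - g s) / (t - s)| < k.
  rewrite -(subrK (deriv01 g s) (_ / _)) (le_lt_trans (ler_normD _ _))//.
  by rewrite /k addrC ltrD2l.
rewrite normrM normfV ltr_pdivrMr// in h2.
rewrite distrC (lt_trans h2)// mulrC -ltr_pdivlMr//.
by rewrite distrC.
Qed.

Lemma derivable01_is_derive (g : R -> R) : derivable01 g -> forall s, 0 < s < 1 ->
  is_derive s 1 g (deriv01 g s).
Proof.
move=> dg s /andP[s0 s1]; apply: is_derive_eps => e e0.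
have s01 : 0 <= s <= 1 by rewrite !ltW.
have [r r0 rP] := deriv01_eps dg s01 e0.
exists (Num.min r (Num.min s (1 - s))); first by rewrite !lt_min r0 s0 subr_gt0 s1.
move=> t /andP[ts]; rewrite !lt_min => /and3P[tr ts0 ts1].
apply: rP; last by rewrite ts tr.
move: ts0 ts1; rewrite !ltr_norml => /andP[? ?] /andP[? ?]; apply/andP; split; lra.
Qed.

Lemma MVT01 (g : R -> R) : derivable01 g -> forall s t, 0 <= s -> s <= t -> t <= 1 ->
  exists2 c, s <= c <= t & g t - g s = deriv01 g c * (t - s).
Proof.
move=> dg s t s0 st t1.
have [c||c cin E] := @MVT_segment _ g (deriv01 g) s t st.
- rewrite in_itv/= => /andP[sc ct]; apply: derivable01_is_derive => //.
  by rewrite (le_lt_trans s0 sc) (lt_le_trans ct t1).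
- apply: continuous_subspaceW (derivable01_continuous dg) => x /=.
  by rewrite !in_itv/= => /andP[sx xt]; rewrite (le_trans s0 sx) (le_trans xt t1).
- by exists c => //; move: cin; rewrite in_itv.
Qed.

Lemma f_derivable01 x : derivable01 (f x). Proof. by case: hf => _ _ _ []. Qed.

Lemma reaction_bounds : exists2 M : R, 0 < M & exists2 gamma : R, 0 < gamma &
  forall x, (forall s, 0 <= s <= 1 -> `|deriv01 (f x) s| <= M) /\
    (forall s, 0 < s <= 1 ->
       `|deriv01 (f x) s - deriv01 (f x) 0| <= M * (s `^ gamma)).
Proof.
case: hf => f01 _ _ [_ [gamma [/andP[g0 g1] hsup]]].
set S := ereal_sup _ in hsup.
have norm_le x : (C1holder_norm gamma (f x) <= S)%E.
  by apply: ereal_sup_ubound; exists x.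
pose M := fine S.
have zin : (0 : R) \in `[0%R, 1%R] by rewrite in_itv/= lexx ler01.
have oin : (1 : R) \in `[0%R, 1%R] by rewrite in_itv/= lexx ler01.
have parts x :
  (ereal_sup [set `|deriv01 (f x) s|%:E | s in `[0%R, 1%R]] <= S)%E /\
  (ereal_sup [set (`|deriv01 (f x) st.1 - deriv01 (f x) st.2|
                       / (`|st.1 - st.2| `^ gamma))%:E |
                st in [set st : R * R | [/\ st.1 \in `[0%R, 1%R],
                         st.2 \in `[0%R, 1%R] & st.1 != st.2]]] <= S)%E.
  have := norm_le x; rewrite /C1holder_norm.
  set A := ereal_sup _; set B := ereal_sup _; set C := ereal_sup _ => ABC.
  (* The summands are suprema in the extended reals; once they are known to be nonnegative, each of
     them is bounded by the whole norm. *)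
  have A0 : (0 <= A)%E by apply: ereal_sup_ge; exists `|f x 0|%:E; [exists 0|rewrite lee_fin].
  have B0 : (0 <= B)%E by apply: ereal_sup_ge; exists `|deriv01 (f x) 0|%:E; [exists 0|rewrite lee_fin].
  have C0 : (0 <= C)%E.
    apply: ereal_sup_ge; exists (`|deriv01 (f x) 1 - deriv01 (f x) 0| / (`|1 - 0| `^ gamma))%:E.
      by exists (1, 0) => //=; split=> //; rewrite oner_eq0.
    by rewrite lee_fin divr_ge0// powR_ge0.
  split; apply: le_trans ABC.
    by rewrite -addeA addeCA leeDl// adde_ge0.
  by rewrite leeDr// adde_ge0.
have S0 : (0 <= S)%E.
  apply: le_trans (parts 0).1.
  by apply: ereal_sup_ge; exists `|deriv01 (f 0) 0|%:E; [exists 0|rewrite lee_fin].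
have SM : S = M%:E by rewrite /M fineK// ge0_fin_numE.
have M0 : 0 <= M by rewrite -lee_fin -SM.
exists (M + 1); first by rewrite ltr_wpDl.
exists gamma => // x; have [pB pC] := parts x; rewrite SM in pB pC; split.
- move=> s s01; rewrite -lee_fin (le_trans _ (le_trans pB _)) ?lee_fin ?lerDl//.
  by apply: ereal_sup_ubound; exists s => //=; rewrite in_itv.
- move=> s /andP[s0 s1]; rewrite -ler_pdivrMr ?powR_gt0//.
  rewrite -lee_fin (le_trans _ (le_trans pC _)) ?lee_fin ?lerDl//.
  apply: ereal_sup_ubound; exists (s, 0) => /=.
    by split=> //; [rewrite in_itv/= ltW|rewrite gt_eqF].
  by rewrite subr0 (gtr0_norm s0).
Qed.

Lemma f_lipschitz : exists2 M : R, 0 < M & forall x s t, 0 <= s <= 1 -> 0 <= t <= 1 ->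
  `|f x t - f x s| <= M * `|t - s|.
Proof.
have [M M0 [g _ MP]] := reaction_bounds; exists M => // x.
have H s t : 0 <= s -> s <= t -> t <= 1 -> `|f x t - f x s| <= M * `|t - s|.
  move=> s0 st t1; have [c /andP[sc ct] ->] := MVT01 (@f_derivable01 x) s0 st t1.
  by rewrite normrM ler_wpM2r// (MP x).1// (le_trans s0 sc) (le_trans ct t1).
move=> s t /andP[s0 s1] /andP[t0 t1].
have [st|/ltW ts] := leP s t; first exact: H.
by rewrite distrC [`|t - s|]distrC; exact: H.
Qed.

Lemma fs0_bounded : exists2 F : R, 0 < F & forall x, `|fs0 f x| <= F.
Proof.
have [M M0 [g _ MP]] := reaction_bounds; exists M => // x.
by apply: (MP x).1; rewrite lexx ler01.
Qed.

Lemma f_le x s : 0 <= s <= 1 -> 0 <= fs0 f x -> f x s <= fs0 f x * s.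
Proof.
case: hf => f01 fs _ _ /andP[]; rewrite !le_eqVlt => /orP[/eqP<-|s0].
  by rewrite (f01 x).1 mulr0 eqxx.
move=> /orP[/eqP-> fx|s1 _]; first by rewrite (f01 x).2 mulr1.
by rewrite -le_eqVlt; apply: (fs s _).2; rewrite s0.
Qed.

Lemma f_inf s : 0 < s < 1 -> exists2 c : R, 0 < c & forall x, c <= f x s.
Proof.
case: hf => _ fs _ _ s01; have [] := fs s s01.
set I := ereal_inf _ => I0 _.
have Ile x : (I <= (f x s)%:E)%E by apply: ereal_inf_lbound; exists x.
have Ifin : I \is a fin_num.
  by rewrite ge0_fin_numE ?ltW// (le_lt_trans (Ile 0))// ltry.
exists (fine I); first by rewrite fine_gt0// I0 ltey_eq Ifin.
by move=> x; rewrite -lee_fin fineK.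
Qed.

(** At [s = 1 / 2] the linear upper bound on [f] turns the positive infimum of [f] into one for
    [fs0 f]. *)
Lemma fs0_inf : exists2 c : R, 0 < c & forall x, c <= fs0 f x.
Proof.
have h01 : (0 < 1 / 2 :> R) && (1 / 2 < 1 :> R) by apply/andP; split; lra.
have [c c0 cP] := f_inf h01; exists c => // x.
have := cP x; case: hf => _ fs _ _; have := (fs _ h01).2 x; lra.
Qed.

Lemma f_leq x s : 0 <= s <= 1 -> f x s <= fs0 f x * s.
Proof. by move=> s01; apply: f_le => //; have [c c0 /(_ x)] := fs0_inf; lra. Qed.

Lemma f_ge0 x s : 0 <= s <= 1 -> 0 <= f x s.
Proof.
case: hf => f01 fs _ _ /andP[]; rewrite !le_eqVlt => /orP[/eqP<-|s0].
  by rewrite (f01 x).1 eqxx.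
move=> /orP[/eqP->|s1]; first by rewrite (f01 x).2 eqxx.
rewrite -le_eqVlt; have s01 : 0 < s < 1 by rewrite s0.
by have [c c0 /(_ x)] := f_inf s01; lra.
Qed.

(** By the mean value theorem [f x s] is [s] times a derivative at some point of [[0, s]], which is
    within [M * s ^ gamma] of [fs0 f x] uniformly in [x]; [e] is chosen to make this at most [d]. *)
Lemma f_ge_linear d : 0 < d -> exists2 e : R, 0 < e <= 1 & forall x s, 0 <= s <= e ->
  (fs0 f x - d) * s <= f x s.
Proof.
move=> d0; have [M M0 [g g0 MP]] := reaction_bounds.
have dM : 0 < d / M by rewrite divr_gt0.
pose e := Num.min 1 ((d / M) `^ g^-1).
have e0 : 0 < e by rewrite lt_min ltr01 powR_gt0.
have e1 : e <= 1 by rewrite ge_min lexx.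
exists e; first by rewrite e0.
move=> x s /andP[s0 se].
have s1 : s <= 1 by rewrite (le_trans se).
have [c /andP[c0 cs]] := MVT01 (@f_derivable01 x) (lexx 0) s0 s1.
have -> : f x 0 = 0 by case: hf => f01 _ _ _; exact: (f01 x).1.
rewrite !subr0 => ->; rewrite ler_wpM2r//.
move: c0; rewrite le_eqVlt => /orP[/eqP<-|c0]; first by rewrite /fs0 lerBlDr lerDl ltW.
have := (MP x).2 c; rewrite c0 (le_trans cs)// => /(_ isT).
have : M * c `^ g <= d.
  rewrite mulrC -ler_pdivlMr//.
  have -> : d / M = ((d / M) `^ g^-1) `^ g by rewrite -powRrM mulVf ?gt_eqF// powRr1// ltW.
  rewrite ge0_ler_powR ?nnegrE ?powR_ge0 ?(ltW c0) ?(ltW g0)//.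
  by rewrite (le_trans cs)// (le_trans se)// ge_min lexx orbT.
rewrite /fs0 ler_norml => h1 /andP[h2 h3]; lra.
Qed.

Lemma f_inf_itv a b : 0 < a -> b < 1 ->
  exists2 c : R, 0 < c & forall x s, a <= s <= b -> c <= f x s.
Proof.
move=> a0 b1; have [M M0 ML] := f_lipschitz.
(* The lower bound is written [i^-1] so that it weakens as [i] grows. It extends to nearby [s]
   because the Lipschitz constant of [f x] does not depend on [x]. *)
have [s /andP[as_ sb]|n nP] := @itv_compact_uniform _ a b (fun i s => forall x, i^-1 <= f x s).
  have s01 : 0 < s < 1 by rewrite (lt_le_trans a0 as_) (le_lt_trans sb b1).
  have [c c0 cP] := f_inf s01.
  exists (Num.min (c / 2 / M) (Num.min s (1 - s))), (c / 2)^-1; split.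
    by rewrite !lt_min !divr_gt0//= subr_gt0.
  move=> s' i; rewrite !lt_min => /and3P[/ltW s1 s2 s3] ii x.
  have : `|f x s' - f x s| <= c / 2.
    rewrite (le_trans (ML x s s' _ _))//.
    - by case/andP: s01 => /ltW-> /ltW->.
    - move: s2 s3; rewrite !ltr_norml => /andP[? ?] /andP[? ?]; apply/andP; split; lra.
    - by rewrite mulrC -ler_pdivlMr.
  rewrite ler_norml => /andP[h1 _].
  have : i^-1 <= c / 2.
    by rewrite -[leRHS]invrK lef_pV2// posrE ?invr_gt0 ?divr_gt0// (lt_le_trans _ ii)// invr_gt0 divr_gt0.
  have := cP x; lra.
pose i := Num.max n 0 + 1.
have i0 : 0 < i by rewrite ltr_wpDl// le_max lexx orbT.
have Ti : n <= i by rewrite (le_trans (_ : _ <= Num.max n 0)) ?lerDl// le_max lexx.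
exists i^-1; first by rewrite invr_gt0.
by move=> x s sab; exact: nP.
Qed.

End reaction.

(** * Pointwise properties of the solution *)

Section solution.
Variables (R : realType) (K f : R -> R -> R) (u0 : R -> R) (u : R -> R -> R).
Hypotheses (hK : dispersal_kernel K) (hu : solution K f u0 u).
Implicit Types (a b s t x y p q c M : R) (g h phi : R -> R).

Lemma u_ge0 t x : 0 <= t -> 0 <= u t x.
Proof. by move=> t0; case: hu => _ /(_ t t0 x)/andP[]. Qed.

Lemma u_le1 t x : 0 <= t -> u t x <= 1.
Proof. by move=> t0; case: hu => _ /(_ t t0 x)/andP[]. Qed.

Lemma u_itv t x : 0 <= t -> 0 <= u t x <= 1.
Proof. by move=> t0; case: hu => _ /(_ t t0 x). Qed.

Lemma u_continuous t : 0 <= t -> continuous (u t).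
Proof. by move=> t0; case: hu => _ _ /(_ 0)[/(_ t t0)[]]. Qed.

(** The weight is 1 at its centre, so that the choice [z = x] turns convergence in [X_z] into
    convergence at the point [x]. *)
Lemma Xnorm_ge phi x : (`|phi x|%:E <= Xnorm x phi)%E.
Proof.
apply: ereal_sup_ubound; exists x => //.
by rewrite subrr normr0 oppr0 expR0 mul1r.
Qed.

Lemma Xnorm_cvg0 (T : Type) (F : set_system T) (FF : Filter F) (h : T -> R -> R) x :
  Xnorm x (h s) @[s --> F] --> 0%E -> forall e : R, 0 < e -> \forall s \near F, `|h s x| < e.
Proof.
move=> hF e e0; have e0' : (0%E < e%:E :> \bar R)%E by rewrite lte_fin.
have hh : \forall s \near F, (Xnorm x (h s) < e%:E)%E by exact: (hF _ (open_ereal_lt' e0')).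
apply: filterS hh => s hs.
 rewrite -lte_fin; apply: le_lt_trans hs; exact: Xnorm_ge.
Qed.

Lemma u_is_derive t x : 0 < t -> is_derive t 1 (u^~ x) (rhs K f (u t) x).
Proof.
move=> t0; apply: is_derive_eps => e e0.
case: hu => _ _ /(_ x)[_ _ /(_ t t0)] /Xnorm_cvg0/(_ e e0).
rewrite near_withinE => -[r r0 rP]; exists r => // s /andP[s0 sr].
by apply: rP; [rewrite /= distrC|rewrite -subr_eq0 -normr_gt0].
Qed.

Lemma u_continuous_time a b x : 0 <= a -> {within `[a, b], continuous (u^~ x)}.
Proof.
move=> a0; apply/subspace_continuousP => t; rewrite /= in_itv/= => /andP[at_ tb].
have t0 : 0 <= t by rewrite (le_trans a0).
apply/cvgrPdist_lt => e e0.
case: hu => _ _ /(_ x)[_ /(_ t t0)] /Xnorm_cvg0/(_ e e0) + _.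
rewrite !near_withinE => -[r r0 rP]; exists r => // s rs; rewrite /= in_itv/= => /andP[as_ sb].
by rewrite distrC; apply: rP => //=; rewrite (le_trans a0).
Qed.

Hypothesis hM : forall p, exists M, forall x, (emoment_on K setT p x <= M%:E)%E.

Lemma Kint_bounded x g M : measurable_fun [set: R] g -> (forall y, `|g y| <= M) -> Kint K x g.
Proof.
move=> mg gM; apply: (Kint_dom hK mg (h := fun y => M * expR (0 * (y - x)))).
  by move=> y; rewrite mul0r expR0 mulr1.
exact/KintZ/Kint_expR.
Qed.

Lemma Kint_cst x c : Kint K x (fun=> c).
Proof. by apply: (@Kint_bounded x _ `|c|) => //; exact: measurable_cst. Qed.

Lemma Kint_u t x : 0 <= t -> Kint K x (u t).
Proof.
move=> t0; apply: (@Kint_bounded x _ 1).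
  by apply: continuous_measurable_fun; exact: u_continuous.
by move=> y; rewrite ger0_norm ?u_ge0// u_le1.
Qed.

Lemma Kop_cst x c : Kop K (fun=> c) x = c * bcoef K x.
Proof.
rewrite (bcoefE K) -(KopZ _ (Kint_cst x 1)).
by congr (Kop K _ x); apply/funext => y; rewrite mulr1.
Qed.

Lemma bcoef_ge0 x : 0 <= bcoef K x.
Proof. by rewrite bcoefE; apply: Kop_ge0. Qed.

Lemma bcoef_bounded : exists2 B : R, 0 < B & forall x, bcoef K x <= B.
Proof.
have [M M0 MP] := Kop_expR_norm_le hK hM 0; exists M => // x.
rewrite bcoefE (le_trans _ (MP x))// le_eqVlt; apply/orP; left; apply/eqP.
by congr (Kop K _ x); apply/funext => y; rewrite mul0r expR0.
Qed.

End solution.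

(** * Truncated Gaussian bumps and their image under the kernel *)

Section gaussian_bump.
Variables (R : realType) (K f : R -> R -> R).
Hypothesis hK : dispersal_kernel K.
Implicit Types (a b s t x y p q c M r A Q P sigma theta : R) (g h phi : R -> R).
Hypothesis hM : forall p, exists M, forall x, (emoment_on K setT p x <= M%:E)%E.

Lemma cutoff_ge0 r x : 0 <= cutoff r x.
Proof. by rewrite /cutoff; case: ifP. Qed.

Lemma cutoff_le1 r x : cutoff r x <= 1.
Proof. by rewrite /cutoff; case: ifP => // _; exact: ler01. Qed.

Lemma measurable_cutoff r c : measurable_fun [set: R] (fun y : R => cutoff r (y - c)).
Proof.
have -> : (fun y : R => cutoff r (y - c)) = \1_(`[c - r, c + r]%classic : set R).
  apply/funext => y; rewrite /cutoff indicE mem_setE in_itv/= ler_distl.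
  by case: ifP.
by apply: measurable_indic; exact: measurable_itv.
Qed.

(** The cutoff makes the comparison with [u >= 0] trivial outside the box. Its radius is [2 * r] so
    that everything cut off is at distance at least [r] from the points within [r] of [x0], where
    the inequality is needed. *)
Definition bump (A sigma theta x0 : R) (phi : R -> R) (r y : R) : R :=
  cutoff (2 * r) (y - x0) *
  (expR (A + sigma * (y - x0) - theta * (y - x0) ^+ 2) * phi y).

Lemma measurable_bump A sigma theta x0 phi r : continuous phi ->
  measurable_fun [set: R] (bump A sigma theta x0 phi r).
Proof.
move=> cphi; apply: measurable_funM; first exact: measurable_cutoff.
apply: continuous_measurable_fun => y; apply: cvgM; last exact: cphi.
apply: continuous_comp; last exact: continuous_expR.
have cy : (fun z : R => z - x0) z @[z --> y] --> y - x0.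
  by apply: cvgB; [exact: cvg_id|exact: cvg_cst].
apply: cvgB; first by apply: cvgD; [exact: cvg_cst|apply: cvgM => //; exact: cvg_cst].
apply: cvgM; first exact: cvg_cst.
by rewrite expr2; apply: cvgM.
Qed.

Lemma Kint_expM p phi M x : continuous phi -> (forall y, `|phi y| <= M) ->
  Kint K x (fun y => expR (p * (y - x)) * phi y).
Proof.
move=> cphi phiM; apply: (Kint_dom hK _ (h := fun y => M * expR (p * (y - x)))).
- apply: continuous_measurable_fun => y; apply: cvgM; last exact: cphi.
  by apply: is_derive_continuous (is_derive_expR1 (is_derive_aff _ _ _)).
- by move=> y; rewrite normrM ger0_norm ?expR_ge0// mulrC ler_wpM2r ?expR_ge0.
- by apply: KintZ => //; exact: Kint_expR.
Qed.

(* Within distance [2 * r] of [x0] the Gaussian factor costs [5 * r * theta]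
   per unit length; farther away [|y - x| >= r]. *)
Lemma bump_lower A sigma theta x0 phi r Q P x y : 0 <= theta -> 0 < r ->
  `|sigma| <= Q -> (forall y, 0 <= phi y <= P) -> `|x - x0| <= r ->
  expR (A + sigma * (x - x0) - theta * (x - x0) ^+ 2) *
  (expR (sigma * (y - x)) * phi y - P * (5 * r * theta + r^-1) * expR ((Q + 1) * `|y - x|))
  <= bump A sigma theta x0 phi r y.
Proof.
move=> th0 r0 sQ phiP xr; have /andP[p0 pP] := phiP y.
set E := expR (A + _ - _); have E0 : 0 < E by exact: expR_gt0.
(* The first term pays for the Gaussian inside the cutoff; the second makes [1 - k * |y - x|]
   nonpositive beyond it, where the bump is 0. *)
set k := 5 * r * theta + r^-1.
have rV : 0 < r^-1 by rewrite invr_gt0.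
have k0 : 0 <= k by rewrite addr_ge0 ?mulr_ge0// ltW.
(* The extra 1 in the exponent [Q + 1] absorbs the factor [|y - x|]. *)
have S1 : expR (sigma * (y - x)) * phi y * (k * `|y - x|) <=
    P * k * expR ((Q + 1) * `|y - x|).
  have -> : expR ((Q + 1) * `|y - x|) = expR (Q * `|y - x|) * expR `|y - x|.
    by rewrite -expRD mulrDl mul1r.
  have -> : P * k * (expR (Q * `|y - x|) * expR `|y - x|) =
     (expR (Q * `|y - x|) * P) * (k * expR `|y - x|) by ring.
  apply: ler_pM; rewrite ?mulr_ge0 ?expR_ge0//.
    apply: ler_pM; rewrite ?expR_ge0// ler_expR (le_trans (ler_norm _))// normrM.
    by rewrite ler_wpM2r.
  by rewrite ler_wpM2l// (le_trans _ (expR_ge1Dx _))// lerDr.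
have S2 : expR (sigma * (y - x)) * phi y - P * k * expR ((Q + 1) * `|y - x|) <=
   expR (sigma * (y - x)) * phi y * (1 - k * `|y - x|).
  by rewrite [leRHS]mulrBr mulr1 lerB.
apply: le_trans (_ : E * (expR (sigma * (y - x)) * phi y * (1 - k * `|y - x|)) <= _).
  by rewrite (ler_wpM2l (ltW E0)).
rewrite /bump /cutoff; case: ifPn => [yr|]; last first.
  rewrite -ltNge mul0r => yr; rewrite (mulr_ge0_le0 (ltW E0))// mulr_ge0_le0//.
    by rewrite mulr_ge0// expR_ge0.
  have : r <= `|y - x|.
    have := ler_normD (y - x) (x - x0); rewrite addrA subrK => h; lra.
  move=> h; rewrite subr_le0; apply: le_trans (_ : r^-1 * `|y - x| <= _).
    by rewrite ler_pdivlMl// mulr1.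
  by rewrite ler_wpM2r// /k lerDr !mulr_ge0// ltW.
rewrite mul1r.
have -> : expR (A + sigma * (y - x0) - theta * (y - x0) ^+ 2) =
   E * (expR (sigma * (y - x)) * expR (- theta * ((y - x0) ^+ 2 - (x - x0) ^+ 2))).
  by rewrite /E -!expRD; congr expR; ring.
rewrite -!mulrA (ler_wpM2l (ltW E0))// ler_wpM2l ?expR_ge0// mulrC ler_wpM2r//.
apply: le_trans (_ : 1 - theta * ((y - x0) ^+ 2 - (x - x0) ^+ 2) <= _); last first.
  by rewrite -mulNr expR_ge1Dx.
rewrite lerB// (_ : _ - _ = (y - x) * (y - x0 + (x - x0))); last by ring.
apply: le_trans (_ : theta * (`|y - x| * (5 * r)) <= _).
  rewrite ler_wpM2l// (le_trans (ler_norm _))// normrM ler_wpM2l//.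
  rewrite (le_trans (ler_normD _ _))//; lra.
rewrite /k [leRHS]mulrDl (_ : theta * _ = 5 * r * theta * `|y - x|); last by ring.
by rewrite lerDl mulr_ge0// ltW.
Qed.

Lemma Kint_bump A sigma theta x0 phi r M x : continuous phi -> 0 <= theta ->
  (forall y, `|phi y| <= M) ->
  Kint K x (bump A sigma theta x0 phi r).
Proof.
move=> cphi th0 phiM; have M0 : 0 <= M := le_trans (normr_ge0 _) (phiM 0).
apply: (Kint_bounded hK hM x (measurable_bump _ _ _ _ _ cphi)
   (M := expR (A + `|sigma| * (`|2 * r|)) * M)) => y.
rewrite /bump /cutoff; case: ifP => [yr|_]; last by rewrite mul0r normr0 mulr_ge0 ?expR_ge0.
rewrite mul1r normrM ger0_norm ?expR_ge0// ler_pM ?expR_ge0// ler_expR.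
rewrite lerBlDr (le_trans (_ : _ <= A + `|sigma| * `|2 * r|))//; last first.
  by rewrite lerDl mulr_ge0// sqr_ge0.
rewrite lerD2l (le_trans (ler_norm _))// normrM ler_wpM2l// (le_trans yr)//.
exact: ler_norm.
Qed.

Lemma Kop_bump_lower A sigma theta x0 phi r Q P M x : continuous phi -> 0 <= theta -> 0 < r ->
  `|sigma| <= Q -> (forall y, 0 <= phi y <= P) -> `|x - x0| <= r ->
  Kop K (fun y => expR ((Q + 1) * `|y - x|)) x <= M ->
  expR (A + sigma * (x - x0) - theta * (x - x0) ^+ 2) *
  (Kop K (fun y => expR (sigma * (y - x)) * phi y) x - P * (5 * r * theta + r^-1) * M)
  <= Kop K (bump A sigma theta x0 phi r) x.
Proof.
move=> cphi th0 r0 sQ phiP xr KM.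
have aphi y : `|phi y| <= P by have /andP[? ?] := phiP y; rewrite ger0_norm.
have P0 : 0 <= P := le_trans (normr_ge0 _) (aphi 0).
have k0 : 0 <= P * (5 * r * theta + r^-1).
  by rewrite mulr_ge0// addr_ge0 ?mulr_ge0// ?invr_ge0 ltW.
have i1 := Kint_expM sigma x cphi aphi.
have i2 := KintZ (- (P * (5 * r * theta + r^-1))) (Kint_expR_norm hK hM (Q + 1) x).
have i3 := KintZ (expR (A + sigma * (x - x0) - theta * (x - x0) ^+ 2)) (KintD i1 i2).
have := Kop_le hK i3 (Kint_bump A sigma x0 r x cphi th0 aphi) _.
rewrite KopZ; last exact: KintD.
rewrite KopD// KopZ; last exact: Kint_expR_norm.
move=> H; apply: le_trans (H _); last first.
  by move=> y; rewrite mulNr; apply: bump_lower.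
by rewrite ler_wpM2l ?expR_ge0// lerD2l mulNr lerN2 ler_wpM2l.
Qed.

End gaussian_bump.

(** * Comparison of [ln u] with profiles *)

Section propagation.
Variables (R : realType) (K f : R -> R -> R) (u0 : R -> R) (u : R -> R -> R).
Hypotheses (hK : dispersal_kernel K) (hf : reaction f) (hu : solution K f u0 u).
Hypothesis hM : forall p : R, exists M : R, forall x, (emoment_on K setT p x <= M%:E)%E.
Implicit Types (a b s t x y z p q c d e m r N M A B C Q P T W Z sigma theta tau delta eta nu : R).
Implicit Types (g h phi : R -> R).
Ltac clear_local := clear - hK hf hu hM.

Lemma Kop_u_ge t x g N : 0 <= t -> Kint K x g -> (forall y, g y - N <= u t y) ->
  Kop K g x - N * bcoef K x <= Kop K (u t) x.
Proof.
move=> t0 ig gu.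
have i1 := Kint_cst hK hM x (- N).
have -> : Kop K g x - N * bcoef K x = Kop K (fun y => g y + - N) x.
  by rewrite KopD// (Kop_cst hK hM) mulNr.
by apply: Kop_le => //; [exact: KintD|exact: (Kint_u hK hu hM)].
Qed.

Lemma Kop_u_le t x g N : 0 <= t -> Kint K x g -> (forall y, u t y <= g y + N) ->
  Kop K (u t) x <= Kop K g x + N * bcoef K x.
Proof.
move=> t0 ig gu.
have i1 := Kint_cst hK hM x N.
have -> : Kop K g x + N * bcoef K x = Kop K (fun y => g y + N) x.
  by rewrite KopD// (Kop_cst hK hM).
by apply: Kop_le => //; [exact: (Kint_u hK hu hM)|exact: KintD].
Qed.

(* The Gaussian factor tilts the logarithmic slopes of the bump by [O(1/r)] only,
   which the gap [delta] absorbs, while it makes the bump smaller than [u] on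
   the boundary of the box of size [r] around [(t0, x0)]. *)
Lemma local_bound delta C Q M r e t0 x0 t1 nu (D : R -> R -> Prop)
    (chi : R -> R -> R) (tau0 sigma0 : R) phi :
  let theta := (4 * C + 4) / r ^+ 2 in
  0 < delta -> 0 <= C -> 0 < M -> 0 < r -> 0 <= t1 < t0 -> 0 < nu <= 1 ->
  (forall x, Kop K (fun y => expR ((Q + 1) * `|y - x|)) x <= M) ->
  (84 * (C + 1)) * (M + 1) * expR (2 * C) / delta <= r ->
  (forall x s, 0 <= s <= e -> (fs0 f x - delta / 4) * s <= f x s) ->
  `|sigma0| <= Q ->
  continuous phi -> (forall y, expR (- C) <= phi y <= expR C) ->
  (forall t x, D t x -> t1 < t -> t <= t0 -> `|x - x0| <= r ->
     (tau0 + delta) * phi x <= Lop K f sigma0 phi x) ->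
  (forall t x, t1 <= t <= t0 -> `|x - x0| <= 2 * r ->
     chi t0 x0 + tau0 * (t - t0) + sigma0 * (x - x0)
       - theta / 2 * ((x - x0) ^+ 2 + (t - t0) ^+ 2) <= chi t x) ->
  (forall t x, t1 <= t <= t0 -> `|x - x0| <= 2 * r -> expR (chi t x + (2 * C + 2)) <= e) ->
  (forall t x, t1 <= t <= t0 -> `|x - x0| <= 2 * r -> ~ (D t x /\ t1 < t) ->
     expR (chi t x + (2 * C + 2)) <= u t x) ->
  (forall t x, t1 <= t <= t0 -> `|x - x0| <= 2 * r -> nu * expR (chi t x) <= u t x) ->
  nu * expR (chi t0 x0) * 2 <= u t0 x0.
Proof.
move=> theta d0 C0 M0 r0 /andP[t1_ge0 t10] /andP[nu0 nu1] KM rge hfe sQ cphi phiP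
  hsub hlin htop hoff hnu.
have th0 : 0 < theta by rewrite divr_gt0 ?exprn_gt0//; lra.
have thr : theta * r ^+ 2 = 4 * C + 4 by rewrite divfK// gt_eqF// exprn_gt0.
have phi_ge0 y : 0 <= phi y <= expR C.
  by have /andP[h ->] := phiP y; rewrite (le_trans _ h) ?expR_ge0.
have aphi y : `|phi y| <= expR C by have /andP[? ?] := phi_ge0 y; rewrite ger0_norm.
(* Since [phi] lies in [[expR (- C), expR C]], the shift [C + 1] makes the bump at least
   [nu * expR (chi t0 x0 + 1)] at the centre. Half of the Gaussian pays for the curvature of [chi];
   the other half is at least [theta / 2 * r ^+ 2 = 2 * C + 2] at distance [r], so there the bump is
   at most [nu * expR (chi t x - 1)]. *)
pose A (t : R) := ln nu + (chi t0 x0 + tau0 * (t - t0) - theta * (t - t0) ^+ 2 + (C + 1)).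
pose v t := bump (A t) sigma0 theta x0 phi r.
pose dA t := tau0 - 2 * theta * (t - t0).
pose dv t x := dA t * v t x.
pose w t x := v t x - u t x.
pose dw t x := dv t x - rhs K f (u t) x.
(* Points with [v > u] have both [t > t1] and [t > t0 - r], so there are none at time [a], where the
   comparison starts. *)
pose a := Num.max t1 (t0 - r).
have at0 : a < t0 by rewrite gt_max t10 gtrBl.
have t1a : t1 <= a by rewrite le_max lexx.
have ra : t0 - r <= a by rewrite le_max lexx orbT.
have a_ge0 : 0 <= a by rewrite (le_trans t1_ge0).
have dvP t x : is_derive t 1 (v^~ x) (dv t x).
  have dAP : is_derive t 1 A (dA t).
    have h1 := is_deriveM1 (is_derive_aff 1 t0 t) (is_derive_aff 1 t0 t).
    have h2 := is_deriveB1 (is_derive_aff tau0 t0 t) (is_deriveZ1 theta h1).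
    have h3 := is_deriveD1 (is_derive_cst (ln nu + chi t0 x0 + (C + 1)) t 1) h2.
    have -> : A = (fun s : R => ln nu + chi t0 x0 + (C + 1) +
        (tau0 * (s - t0) - theta * (1 * (s - t0) * (1 * (s - t0))))).
      by apply/funext => s; rewrite /A; ring.
    by apply: (is_derive_eq h3); rewrite /dA; ring.
  have h1 := is_deriveD1 dAP (is_derive_cst (sigma0 * (x - x0) - theta * (x - x0) ^+ 2) t 1).
  have h2 := is_deriveZ1 (cutoff (2 * r) (x - x0) * phi x) (is_derive_expR1 h1).
  have -> : v^~ x = (fun s : R => cutoff (2 * r) (x - x0) * phi x *
      expR (A s + (sigma0 * (x - x0) - theta * (x - x0) ^+ 2))).
    by apply/funext => s; rewrite /v /bump -[A s + _ - _]addrA; ring.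
  by apply: (is_derive_eq h2); rewrite /dv /v /bump -[A t + _ - _]addrA; ring.
pose E t x := expR (A t + sigma0 * (x - x0) - theta * (x - x0) ^+ 2).
have vin t x : `|x - x0| <= 2 * r -> v t x = E t x * phi x.
  by move=> xr; rewrite /v /bump /cutoff xr mul1r.
have vout t x : ~~ (`|x - x0| <= 2 * r) -> v t x = 0.
  by move=> /negbTE xr; rewrite /v /bump /cutoff xr mul0r.
have v_le t x : t1 <= t <= t0 -> `|x - x0| <= 2 * r ->
    v t x <= nu * expR (chi t x + (2 * C + 1) - theta / 2 * ((x - x0) ^+ 2 + (t - t0) ^+ 2)).
  move=> tt xr; rewrite vin//.
  have -> : E t x = nu * expR (A t - ln nu + sigma0 * (x - x0) - theta * (x - x0) ^+ 2).
    by rewrite -{1}(lnK nu0) -expRD /E; congr expR; ring.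
  rewrite -mulrA (ler_wpM2l (ltW nu0))//.
  have /andP[? p2] := phiP x.
  rewrite (le_trans (ler_wpM2l (expR_ge0 _) p2))// -expRD ler_expR.
  have := hlin t x tt xr; rewrite /A; lra.
have v_le2 t x : t1 <= t <= t0 -> `|x - x0| <= 2 * r -> v t x <= expR (chi t x + (2 * C + 2)).
  move=> tt xr; rewrite (le_trans (v_le t x tt xr))// (le_trans (ler_piMl (expR_ge0 _) nu1))//.
  rewrite ler_expR.
  have : 0 <= theta / 2 * ((x - x0) ^+ 2 + (t - t0) ^+ 2).
    by rewrite mulr_ge0// ?addr_ge0 ?sqr_ge0// divr_ge0// ltW.
  lra.
have v_far t x : t1 <= t <= t0 -> `|x - x0| <= 2 * r ->
    r ^+ 2 <= (x - x0) ^+ 2 + (t - t0) ^+ 2 -> v t x <= u t x.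
  move=> tt xr dr; rewrite (le_trans _ (hnu t x tt xr))// (le_trans (v_le t x tt xr))//.
  rewrite (ler_wpM2l (ltW nu0))// ler_expR.
  have : theta / 2 * r ^+ 2 <= theta / 2 * ((x - x0) ^+ 2 + (t - t0) ^+ 2).
    by rewrite ler_wpM2l// divr_ge0// ltW.
  have : theta / 2 * r ^+ 2 = 2 * C + 2 by rewrite mulrAC thr; lra.
  lra.
have w_pos t x : a <= t <= t0 -> 0 < w t x ->
    [/\ `|x - x0| <= r, `|x - x0| <= 2 * r, D t x, t1 < t & t0 - r < t].
  move=> /andP[at_ tt0] wpos.
  have tt : t1 <= t <= t0 by rewrite tt0 (le_trans t1a at_).
  have t_ge0 : 0 <= t by rewrite (le_trans a_ge0).
  have xr2 : `|x - x0| <= 2 * r.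
    apply: contraTT wpos => xr; rewrite -leNgt /w vout// sub0r oppr_le0.
    exact: (u_ge0 hu).
  have [Dtx t1t] : D t x /\ t1 < t.
    apply: contrapT => nD; move: wpos; rewrite /w subr_gt0 ltNge => /negP; apply.
    by rewrite (le_trans (v_le2 t x tt xr2))// hoff.
  have dr : (x - x0) ^+ 2 + (t - t0) ^+ 2 < r ^+ 2.
    rewrite ltNge; apply/negP => dr.
    by have := v_far t x tt xr2 dr; move: wpos; rewrite /w; lra.
  split=> //.
    rewrite -ler_sqr ?nnegrE ?normr_ge0 ?(ltW r0)// real_normK ?num_real// ltW//.
    by rewrite (le_lt_trans _ dr)// lerDl sqr_ge0.
  have : `|t - t0| < r.
    rewrite -ltr_sqr ?nnegrE ?normr_ge0 ?(ltW r0)// real_normK ?num_real//.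
    by rewrite (le_lt_trans _ dr)// lerDr sqr_ge0.
  by rewrite ltr_norml => /andP[h _]; lra.
have e_ge0 : 0 <= e.
  apply: le_trans (htop t0 x0 _ _); first exact: expR_ge0.
    by rewrite lexx andbT ltW.
  by rewrite subrr normr0 mulr_ge0// ltW.
have [B B0 BP] := bcoef_bounded hK hM.
have [F F0 FP] := fs0_bounded hf.
suff w0 : w t0 x0 <= 0.
  move: w0; rewrite /w subr_le0; apply: le_trans.
  rewrite vin; last by rewrite subrr normr0 mulr_ge0// ltW.
  have -> : E t0 x0 = nu * expR (chi t0 x0) * expR (C + 1).
    by rewrite -{1}(lnK nu0) -!expRD /E /A; congr expR; ring.
  rewrite -[leRHS]mulrA ler_wpM2l ?mulr_ge0 ?expR_ge0 ?(ltW nu0)//.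
  have /andP[p1 _] := phiP x0.
  apply: le_trans (ler_wpM2l (expR_ge0 _) p1).
  by rewrite -expRD (_ : C + 1 - C = 1) ?expR_ge1Dx//; ring.
(* The constant is [84 = 4 * 21]: the loss [5 * r * theta + r^-1] is at most [21 * (C + 1) / r] and
   has to fit in a quarter of [delta], after multiplication by the ratio [expR (2 * C)] of the
   bounds on [phi]. *)
have rI : (84 * (C + 1)) * (M + 1) * expR (2 * C) * r^-1 <= delta.
  by move: rge; rewrite ler_pdivrMr// => h; rewrite ler_pdivrMr// [leRHS]mulrC.
have I0 : 0 < r^-1 by rewrite invr_gt0.
have X1 : 1 <= expR (2 * C) by rewrite -expR0 ler_expR mulr_ge0.
have thrE : theta * r = 4 * (C + 1) * r^-1.
  by rewrite /theta; field; rewrite gt_eqF.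
have CC : 0 <= (B + F) + B by rewrite !addr_ge0// ltW.
have cmp := @comparison _ w dw a t0 (B + F + B) e CC.
apply: cmp; last by rewrite lexx ltW.
- move=> x t; apply: cvgB; last exact: (u_continuous_time hu).
  have cv : continuous (v^~ x) by move=> s; exact: is_derive_continuous (dvP s x).
  exact: continuous_subspaceT cv t.
- move=> t x /andP[at_ _]; have h1 := dvP t x.
  have h2 := u_is_derive hu x (le_lt_trans a_ge0 at_).
  exact: (is_deriveB1 h1 h2).
- move=> x; rewrite leNgt; apply/negP => wa.
  have [] := w_pos a x _ wa; first by rewrite lexx ltW.
  move=> _ _ _ h1 h2; have : Num.max t1 (t0 - r) < a by rewrite gt_max h1.
  by rewrite ltxx.
- move=> t x /andP[at_ tt0]; rewrite /w lerBlDr.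
  have tt : t1 <= t <= t0 by rewrite tt0 (le_trans t1a at_).
  have u0' : 0 <= u t x by rewrite (u_ge0 hu)// (le_trans a_ge0).
  have [xr|xr] := boolP (`|x - x0| <= 2 * r); last by rewrite vout// addr_ge0.
  by rewrite (le_trans (v_le2 t x tt xr))// (le_trans (htop t x tt xr))// lerDl.
- move=> t N /andP[at_ tt0] N0 wN x wpos.
  have tt' : a <= t <= t0 by rewrite !ltW.
  have [xr xr2 Dtx t1t t0r] := w_pos t x tt' wpos.
  have tt : t1 <= t <= t0 by rewrite (ltW tt0) (ltW t1t).
  have tpos : 0 <= t by rewrite (le_trans a_ge0)// ltW.
  have wNx := wN x.
  have U0 := u_ge0 hu x tpos.
  have hKu : Kop K (v t) x - N * bcoef K x <= Kop K (u t) x.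
    apply: Kop_u_ge => //; first exact: (Kint_bump hK hM _ _ _ _ _ cphi (ltW th0) aphi).
    by move=> y; have := wN y; rewrite /w; clear_local; lra.
  have hKv := Kop_bump_lower hK hM (A t) cphi (ltW th0) r0 sQ phi_ge0 xr (KM x).
  have hL := hsub t x Dtx t1t (ltW tt0) xr; rewrite LopE in hL.
  have Ve : v t x <= e by rewrite (le_trans (v_le2 t x tt xr2)) ?htop.
  have hfx : (fs0 f x - delta / 4) * u t x <= f x (u t x).
    by apply: hfe; rewrite U0/=; move: wpos Ve; rewrite /w; clear_local; lra.
  have E0 : 0 < E t x := expR_gt0 _.
  have /andP[p1 p2] := phiP x.
  (* The gap [delta] is spent in quarters: one on the spatial error of the bump, one on its tilt in
     time, one on the linearization of [f]. *)
  have kap : expR C * (5 * r * theta + r^-1) * M <= delta / 4 * phi x.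
    rewrite (le_trans _ (ler_wpM2l _ p1))//; last by rewrite divr_ge0// ltW.
    rewrite expRN ler_pdivlMr ?expR_gt0//.
    have -> : 5 * r * theta = 20 * (C + 1) * r^-1.
      by rewrite mulrAC -mulrA thrE; ring.
    have -> : expR C * (20 * (C + 1) * r^-1 + r^-1) * M * expR C =
        (20 * (C + 1) + 1) * M * (expR (2 * C) * r^-1).
      by rewrite (_ : 2 * C = C + C) ?expRD; ring.
    apply: le_trans (_ : (21 * (C + 1)) * (M + 1) * (expR (2 * C) * r^-1) <= _); last by move: rI; clear_local; lra.
    rewrite ler_wpM2r ?mulr_ge0 ?expR_ge0 ?(ltW I0)// ler_pM//; move: M0 C0; clear_local; lra.
  have tht : - (2 * theta * (t - t0)) <= delta / 4.
    apply: le_trans (_ : 2 * (theta * r) <= _).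
      have : 0 <= theta * (r + (t - t0)) by rewrite mulr_ge0 ?(ltW th0)//; move: t0r; clear_local; lra.
      clear_local; lra.
    rewrite thrE.
    have : (C + 1) * r^-1 * 1 <= (C + 1) * r^-1 * ((M + 1) * expR (2 * C)).
      rewrite ler_wpM2l ?mulr_ge0 ?(ltW I0)//; first by move: C0; clear_local; lra.
      by rewrite -[leLHS]mulr1 ler_pM//; move: M0; clear_local; lra.
    have : 0 <= (C + 1) * r^-1 by rewrite mulr_ge0 ?(ltW I0)//; move: C0; clear_local; lra.
    move: rI; clear_local; lra.
  have hKv2 : v t x * (tau0 + 3 * delta / 4 + acoef K f x) <= Kop K (v t) x.
    apply: le_trans hKv; rewrite vin// -mulrA (ler_wpM2l (ltW E0))//.
    move: kap hL; clear_local; lra.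
  have Ux : u t x < v t x by move: wpos; rewrite /w; clear_local; lra.
  have V0 : 0 <= v t x by move: Ux U0; clear_local; lra.
  have VU0 : 0 <= v t x - u t x by move: Ux; clear_local; lra.
  have hb := BP x; have hb0 := bcoef_ge0 hK x.
  have ha : `|acoef K f x| <= B + F.
    by rewrite (le_trans (ler_normB _ _))// lerD// ger0_norm.
  rewrite /dw /dv /rhs /dA.
  have h1 : (tau0 - 2 * theta * (t - t0)) * v t x <= (tau0 + delta / 4) * v t x.
    by rewrite ler_wpM2r//; move: tht; clear_local; lra.
  have h2 : N * bcoef K x <= N * B by rewrite ler_wpM2l.
  have h3 : - acoef K f x * (v t x - u t x) <= (B + F) * N.
    rewrite (le_trans (ler_norm _))// normrM normrN ler_pM//.
    by rewrite ger0_norm.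
  have aE : acoef K f x = bcoef K x - fs0 f x by [].
  rewrite aE in h3 hKv2.
  have h4 : 0 <= delta / 2 * v t x - delta / 4 * u t x.
    have : 0 <= delta * (v t x - u t x) by rewrite mulr_ge0// ltW.
    have : 0 <= delta * v t x by rewrite mulr_ge0// ltW.
    clear_local; lra.
  move: (Kop K (v t) x) (Kop K (u t) x) (f x (u t x)) (bcoef K x) (fs0 f x) (v t x) (u t x)
    h1 h2 h3 h4 hKv2 hKu hfx => Kv Ku fu b f0 V U.
  clear => h1 h2 h3 h4 h5 h6 h7; lra.
Qed.


(** [D] is the region where the profile relies on the eigenvalue inequality; elsewhere in the strip
    [u] is above the profile by the margin [2 * C + 2], which covers the oscillation of any test
    function. [r] and [eta] are produced before the profile, so that it can be chosen flat enough
    for them. *)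
Lemma propagation_bound delta C Q : 0 < delta -> 0 <= C ->
  exists r eta : R, [/\ 0 < r, 0 < eta &
  forall e t1 t2 Z1 Z2 m (D : R -> R -> Prop) (chi tau sigma : R -> R -> R),
  0 <= t1 -> 0 < m ->
  (forall x s, 0 <= s <= e -> (fs0 f x - delta / 4) * s <= f x s) ->
  (forall t0 x0 t x, D t0 x0 -> t1 <= t <= t2 ->
     chi t0 x0 + tau t0 x0 * (t - t0) + sigma t0 x0 * (x - x0)
       - eta * ((x - x0) ^+ 2 + (t - t0) ^+ 2) <= chi t x) ->
  (forall t x, D t x -> [/\ t1 < t, t <= t2, Z1 + 2 * r <= x <= Z2 - 2 * r & `|sigma t x| <= Q]) ->
  (forall t x, t1 <= t <= t2 -> expR (chi t x + (2 * C + 2)) <= e) ->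
  (forall t x, t1 <= t <= t2 -> Z1 <= x <= Z2 -> m <= u t x) ->
  (forall t x, t1 <= t <= t2 -> Z1 <= x <= Z2 -> ~ D t x ->
     expR (chi t x + (2 * C + 2)) <= u t x) ->
  (forall t0 x0, D t0 x0 -> exists phi, [/\ continuous phi,
     (forall y, expR (- C) <= phi y <= expR C) &
     forall t x, D t x -> `|x - x0| <= r ->
       (tau t0 x0 + delta) * phi x <= Lop K f (sigma t0 x0) phi x]) ->
  forall t x, D t x -> expR (chi t x) <= u t x].
Proof.
move=> d0 C0; have [M M0 MP] := Kop_expR_norm_le hK hM (Q + 1).
pose r := (84 * (C + 1)) * (M + 1) * expR (2 * C) / delta + 1.
have r0 : 0 < r.
  by rewrite ltr_wpDl// divr_ge0 ?(ltW d0)// !mulr_ge0 ?expR_ge0 ?addr_ge0 ?(ltW M0).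
pose eta := (4 * C + 4) / r ^+ 2 / 2.
have eta0 : 0 < eta by rewrite divr_gt0// divr_gt0 ?exprn_gt0// ltr_wpDl// mulr_ge0.
exists r, eta; split=> // e t1 t2 Z1 Z2 m D chi tau sigma t1_ge0 m0 hfe hlin hD htop hm hoff hsub.
pose S := [set y | exists t x, D t x /\ y = u t x * expR (- chi t x)].
have S0 y : S y -> m / e <= y.
  move=> [t [x [Dtx ->]]]; have [t1t tt2 xZ _] := hD t x Dtx.
  have tt : t1 <= t <= t2 by rewrite ltW.
  have ce : expR (chi t x) <= e.
    rewrite (le_trans _ (htop t x tt))// ler_expR lerDl addr_ge0// mulr_ge0//.
  have e0 : 0 < e := lt_le_trans (expR_gt0 _) ce.
  rewrite ler_pM ?invr_ge0 ?(ltW m0) ?(ltW e0)//.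
    apply: hm => //; move: xZ r0; clear_local => /andP[h1 h2] h3; apply/andP; split; lra.
  by rewrite expRN lef_pV2 ?posrE ?expR_gt0.
move=> t x Dtx.
have Sne : S !=set0 by exists (u t x * expR (- chi t x)), t, x.
have e0 : 0 < e.
  have [t1t tt2 _ _] := hD t x Dtx.
  by apply: lt_le_trans (htop t x _); rewrite ?expR_gt0// ltW.
pose nu := inf S.
have nu0 : 0 < nu.
  by apply: lt_le_trans (divr_gt0 m0 e0) _; exact: lb_le_inf.
have hinf : has_inf S by split => //; exists (m / e).
have nuS t' x' : D t' x' -> nu * expR (chi t' x') <= u t' x'.
  move=> D'; rewrite -ler_pdivlMr ?expR_gt0// -expRN; apply: ge_inf; last by exists t', x'.
  by exists (m / e).
have [nu1|nu1] := leP 1 nu.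
  by rewrite (le_trans _ (nuS t x Dtx))// ler_peMl ?expR_ge0.
exfalso.
(* The infimum [nu] of [u / expR chi] over [D] need not be attained. A point with ratio below
   [2 * nu] is enough, because [local_bound] gains the factor 2 at its centre. *)
have [_ [t0 [x0 [D0 ->]]]] : exists2 y, S y & y < nu + nu.
  by apply: inf_adherent.
rewrite expRN ltr_pdivrMr ?expR_gt0// => ult.
have [phi [cphi phiP phiD]] := hsub t0 x0 D0.
have [t10 t02 x0Z sQ] := hD t0 x0 D0.
have inZ y : `|y - x0| <= 2 * r -> Z1 <= y <= Z2.
  move: x0Z; clear_local => /andP[h1 h2]; rewrite ler_norml => /andP[h3 h4].
  apply/andP; split; lra.
have tt2 s : t1 <= s <= t0 -> t1 <= s <= t2.
  by move=> /andP[-> st0]; rewrite (le_trans st0).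
have off s y : t1 <= s <= t0 -> `|y - x0| <= 2 * r -> ~ D s y ->
     expR (chi s y + (2 * C + 2)) <= u s y.
  by move=> ss yx nD; apply: hoff => //; [exact: tt2|exact: inZ].
suff : nu * expR (chi t0 x0) * 2 <= u t0 x0.
  by rewrite leNgt mulr_natr mulr2n -mulrDl ult.
apply: (@local_bound delta C Q M r e t0 x0 t1 nu D chi (tau t0 x0) (sigma t0 x0) phi) => //.
- by rewrite t1_ge0.
- by rewrite nu0 ltW.
- by rewrite /r lerDl.
- by move=> s y Dsy _ _ yr; exact: (phiD s y Dsy yr).
- by move=> s y ss _; apply: hlin => //; exact: tt2.
- by move=> s y ss _; apply: htop; exact: tt2.
- move=> s y ss yx nD; apply: off => // Dsy; apply: nD; split => //.
  by have [] := hD s y Dsy.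
- move=> s y ss yx; have [/nuS//|nD] := pselect (D s y).
  rewrite (le_trans _ (off s y ss yx nD))// (le_trans (ler_piMl (expR_ge0 _) (ltW nu1)))//.
  by rewrite ler_expR lerDl addr_ge0// mulr_ge0.
Qed.

End propagation.

Lemma unif_continuous_continuous (R : realType) (phi : R -> R) :
  unif_continuous phi -> continuous phi.
Proof.
move=> uc x; apply/cvg_entourageP => A eA.
have eB : entourage [set xy | A (phi xy.1, phi xy.2)] by exact: uc.
by have := nbhs_entourage x eB; apply: filterS => y; rewrite /xsection/= inE.
Qed.

Lemma cvge0_pinfty (R : realType) (g : R -> \bar R) :
  (forall e : R, 0 < e -> exists T : R, forall t, T <= t -> (0 <= g t <= e%:E)%E) ->
  g t @[t --> +oo] --> 0%E.
Proof.
move=> H.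
have fin T e t : (forall t, T <= t -> (0 <= g t <= e%:E)%E) -> T <= t -> g t \is a fin_num.
  by move=> h /h /andP[g0 ge]; rewrite ge0_fin_numE// (le_lt_trans ge)// ltry.
have pinf (T : R) : \forall t \near +oo, T <= t.
  by apply: nbhs_pinfty_ge; rewrite num_real.
rewrite -[0%E]/(0%:E); apply/fine_cvgP; split.
  have [T TP] := H 1 ltr01.
  by apply: filterS (pinf T) => t; exact: fin TP.
apply/cvgrPdist_le => e e0; have [T TP] := H e e0.
apply: filterS (pinf T) => t Tt.
rewrite sub0r normrN; have /andP[g0 ge] := TP t Tt.
rewrite /= ger0_norm ?fine_ge0//.
by rewrite -lee_fin fineK//; exact: fin TP Tt.
Qed.

(** * Generalized principal eigenvalues *)

Section spectral.
Variables (R : realType) (K f : R -> R -> R).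
Hypotheses (hK : dispersal_kernel K) (hf : reaction f).
Hypothesis hM : forall p : R, exists M : R, forall x, (emoment_on K setT p x <= M%:E)%E.
Implicit Types (a b s t x y z p q c d e m r w l N M A B C Q P T W Z rho kappa : R).
Implicit Types (g h phi : R -> R).
Ltac clear_local := clear - hK hf hM.

Lemma kfun_gt c p : (c%:E < kfun K f p)%E ->
  exists rho, forall x, rho <= `|x| -> c <= moment K p x - acoef K f x.
Proof.
rewrite /kfun limf_einfE => /ereal_sup_gt[_ [V [T [_ TV]] <-] cV].
exists (T + 1) => x Tx.
have VT : V (T + 1) by apply: TV; rewrite ltrDl.
rewrite -lee_fin; apply/ltW/(lt_le_trans cV).
apply: (@le_trans _ _ (ereal_inf [set (moment K p x - bcoef K x + fs0 f x)%:E |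
               x in [set x | T + 1 <= `|x|]])).
  by apply: ereal_inf_lbound; exists (T + 1).
by apply: ereal_inf_lbound; exists x => //; rewrite /acoef; congr EFin; ring.
Qed.

Lemma kfun_pos p : (0 < kfun K f p)%E -> exists kappa, 0 < kappa /\
  exists rho, forall x, rho <= `|x| -> kappa <= moment K p x - acoef K f x.
Proof.
move=> k0; have [c c0 cP] : exists2 c : R, 0 < c & (c%:E < kfun K f p)%E.
  case: (kfun K f p) k0 => [k|_|//].
    by rewrite lte_fin => k0; exists (k / 2); rewrite ?lte_fin; lra.
  by exists 1; rewrite ?ltry.
by exists c; split => //; exact: kfun_gt.
Qed.

Lemma I_mono r s : r <= s -> I_ (s%:E) `<=` (I_ (r%:E) : set R).
Proof. by move=> rs x; rewrite /I_/= !lte_fin; exact: le_lt_trans. Qed.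

(** By monotonicity in [r] the limit defining [H_upper] is an infimum, so the strict inequality
    passes through three nested infima down to one test function. *)
Lemma omega_upper_lt w : (omega_upper K f < w%:E)%E ->
  exists p l r phi, [/\ 0 < p, l < w * p, test_function phi &
    forall x, r < x -> Lop K f (- p) phi x <= l * phi x].
Proof.
move=> /ereal_inf_lt[_ [p /= p0 <-]]; rewrite lte_pdivrMr//.
have -> : H_upper K f (- p) = ereal_inf (range (fun r => lambda1_upper K f (- p) r%:E)).
  apply/cvg_lim => //; apply: nonincreasing_cvge => r s rs.
  apply: le_ereal_inf => _ [l [phi tphi lP] <-]; exists l => //; exists phi => // x xs.
  by apply: lP; exact: I_mono xs.
move=> /ereal_inf_lt[_ [r _ <-]] /ereal_inf_lt[_ [l [phi tphi lP] <-]] lw.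
by exists p, l, r, phi.
Qed.

Lemma omega_lower_gt w p : 0 < p -> (w%:E < omega_lower K f)%E ->
  exists l r phi, [/\ w * p < l, test_function phi &
    forall x, r < x -> l * phi x <= Lop K f (- p) phi x].
Proof.
move=> p0 wo.
have : (w%:E < H_lower K f (- p) * (p^-1)%:E)%E.
  by apply: (lt_le_trans wo); apply: ereal_inf_lbound; exists p.
rewrite lte_pdivlMr//.
have -> : H_lower K f (- p) = ereal_sup (range (fun r => lambda1_lower K f (- p) r%:E)).
  apply/cvg_lim => //; apply: nondecreasing_cvge => r s rs.
  apply: le_ereal_sup => _ [l [phi tphi lP] <-]; exists l => //; exists phi => // x xs.
  by apply: lP; exact: I_mono xs.
move=> /ereal_sup_gt[_ [r _ <-]] /ereal_sup_gt[_ [l [phi tphi lP] <-]] lw.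
by exists l, r, phi.
Qed.

Lemma acoef_bounded : exists2 A, 0 < A & forall x, `|acoef K f x| <= A.
Proof.
have [B B0 BP] := bcoef_bounded hK hM; have [F F0 FP] := fs0_bounded hf.
exists (B + F); first exact: addr_gt0.
move=> x; rewrite (le_trans (ler_normB _ _))// lerD//.
by rewrite ger0_norm ?bcoef_ge0.
Qed.

Lemma test_function_bounds phi : test_function phi -> continuous phi /\
  exists m M, [/\ 0 < m, 0 < M & forall x, m <= phi x <= M].
Proof.
move=> [/unif_continuous_continuous cphi [m [M [m0 mM]]]]; split=> //; exists m, M; split=> //.
by have /andP[a b] := mM 0; exact: lt_le_trans m0 (le_trans a b).
Qed.

(* Far to the right and near the lower limit of [phi] at [+oo], the operator
   [L_p] acts on [phi] almost as on a constant. *)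
Lemma eigenvalue_gt0 p l r phi : (0 < kfun K f p)%E -> test_function phi ->
  (forall x, r < x -> Lop K f p phi x <= l * phi x) -> 0 < l.
Proof.
move=> /kfun_pos[kappa [kappa0 [rho rhoP]]] /test_function_bounds[cphi [m [Mp [m0 Mp0 phiP]]]] hl.
rewrite ltNge; apply/negP => l0.
have [A A0 AP] := acoef_bounded.
have [M M0 MP] := Kop_expR_norm_le hK hM (`|p| + 1).
(* [sup S] is the lower limit of [phi] at [+oo]. *)
pose S := [set c | exists s, forall x, s <= x -> c <= phi x].
have Sm : S m by exists 0 => x _; have /andP[] := phiP x.
have ubS : ubound S Mp.
  by move=> c [s sP]; rewrite (le_trans (sP s _))//; have /andP[] := phiP s.
have hS : has_sup S by split; [exists m|exists Mp].
have mS : m <= sup S by apply: ub_le_sup => //; exists Mp.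
(* The first bound keeps [c >= m / 2]; the second makes the error [A * (2 * e)], due to [phi x]
   differing from [c], smaller than the gain [c * kappa / 2]. *)
pose e := Num.min (m / 2) (m * kappa / (16 * (A + 1))).
have e0 : 0 < e by rewrite lt_min !divr_gt0 ?mulr_gt0// addr_gt0.
have [c [s sP] Sc] := sup_adherent e0 hS.
(* [phi >= c] will hold within distance [d] of the chosen point; what lies farther away costs at
   most [c * M / d = c * kappa / 2]. *)
pose d := 2 * M / kappa.
have d0 : 0 < d by rewrite divr_gt0// mulr_gt0.
pose s1 := Num.max (s + d) (Num.max (r + 1) rho).
have [x xs1 phix] : exists2 x, s1 <= x & phi x < sup S + e.
  apply: contrapT => h; have : S (sup S + e).
    exists s1 => x xs; rewrite leNgt; apply/negP => hx; apply: h; by exists x.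
  move=> /(ub_le_sup hS.2); rewrite gerDl leNgt e0//.
move: xs1; rewrite !ge_max => /and3P[xsd xr xrho].
have sx : s <= x by rewrite (le_trans _ xsd)// lerDl ltW.
have rx : r < x by rewrite (lt_le_trans _ xr)// ltrDl.
have aphi y : `|phi y| <= Mp.
  by have /andP[h1 h2] := phiP y; rewrite ger0_norm// (le_trans (ltW m0)).
have em : e <= m / 2 by rewrite ge_min lexx.
have c0 : m / 2 <= c by move: Sc em mS; clear_local; lra.
have cx := sP x sx.
have hL := hl x rx; rewrite LopE in hL.
have lphi : l * phi x <= 0.
  by rewrite mulr_le0_ge0//; have /andP[h1 h2] := phiP x; rewrite (le_trans (ltW m0)).
have i1 := Kint_expR hK hM p x.
have i2 := KintZ (- d^-1) (Kint_expR_norm hK hM (`|p| + 1) x).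
have i3 := KintZ c (KintD i1 i2).
have low : c * (moment K p x - d^-1 * M) <= Kop K (fun y => expR (p * (y - x)) * phi y) x.
  apply: le_trans (Kop_le hK i3 (Kint_expM hK hM p x cphi aphi) _).
    rewrite KopZ; last exact: KintD.
    apply: ler_wpM2l; first by rewrite (le_trans _ c0)// divr_ge0// ltW.
    rewrite KopD// KopZ; last exact: Kint_expR_norm.
    by rewrite -momentE// lerD2l mulNr lerN2 ler_wpM2l ?invr_ge0 ?(ltW d0).
  move=> y.
  have E0 := expR_gt0 (p * (y - x)).
  have c_ge0 : 0 <= c by rewrite (le_trans _ c0)// divr_ge0// ltW.
  apply: (@le_trans _ _ (c * (expR (p * (y - x)) * (1 - d^-1 * `|y - x|)))).
    apply: ler_wpM2l => //; rewrite [leRHS]mulrBr mulr1 lerD2l mulNr lerN2.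
    have -> : expR (p * (y - x)) * (d^-1 * `|y - x|) =
      d^-1 * (expR (p * (y - x)) * `|y - x|) by ring.
    rewrite ler_wpM2l ?invr_ge0 ?(ltW d0)// mulrDl mul1r expRD ler_pM ?expR_ge0//.
      by rewrite ler_expR (le_trans (ler_norm _))// normrM.
    by rewrite (le_trans _ (expR_ge1Dx _))// lerDr.
  rewrite mulrCA (ler_wpM2l (ltW E0))//.
  have [sy|ys] := leP s y.
    rewrite (le_trans _ (sP y sy))// ler_piMr// gerBl mulr_ge0// invr_ge0 ltW//.
  have /andP[h1 _] := phiP y; apply: le_trans (le_trans (ltW m0) h1).
  rewrite mulr_ge0_le0// subr_le0 ler_pdivlMl// mulr1.
  by rewrite distrC (le_trans _ (ler_norm _))//; move: xsd ys; clear_local; lra.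
have kx := rhoP x (le_trans xrho (ler_norm x)).
have dM : d^-1 * M = kappa / 2 by rewrite /d; field; rewrite !gt_eqF.
rewrite dM in low.
have h1 : acoef K f x * (phi x - c) <= A * (2 * e).
  rewrite (le_trans (ler_norm _))// normrM ler_pM// ger0_norm.
    by move: Sc phix; clear_local; lra.
  by rewrite subr_ge0.
have h2 : c * kappa <= c * (moment K p x - acoef K f x).
  by rewrite ler_wpM2l// (le_trans _ c0)// divr_ge0// ltW.
have h3 : c * kappa / 2 <= A * (2 * e).
  by move: hL lphi low h1 h2; clear_local; lra.
have h4 : (A + 1) * e <= m * kappa / 16.
  have : e <= m * kappa / (16 * (A + 1)) by rewrite ge_min lexx orbT.
  rewrite -(ler_pM2l (_ : 0 < A + 1)); last exact: addr_gt0.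
  move=> h; rewrite (le_trans h)// le_eqVlt; apply/orP; left; apply/eqP.
  by field; rewrite gt_eqF// addr_gt0.
have h5 : m / 2 * kappa <= c * kappa by rewrite ler_wpM2r// ltW.
have mk : 0 < m * kappa by exact: mulr_gt0.
by move: h3 h4 h5 mk e0; clear_local; lra.
Qed.

End spectral.

(** * Upper bound on the spreading speed *)

Section upper_bound.
Variables (R : realType) (K f : R -> R -> R) (u0 : R -> R) (u : R -> R -> R).
Hypotheses (hK : dispersal_kernel K) (hf : reaction f) (hu : solution K f u0 u).
Hypothesis hu0 : initial_datum u0.
Hypothesis hM : forall p : R, exists M : R, forall x, (emoment_on K setT p x <= M%:E)%E.
Implicit Types (a b s t x y z p q c d e m r w l N M A B C Q P T W Z rho kappa : R).
Implicit Types (g h phi : R -> R).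
Ltac clear_local := clear - hK hf hu hu0 hM.

Lemma u0_support : exists rho, forall x, rho < x -> u0 x = 0.
Proof.
case: hu0 => _ _ /compact_bounded/ex_strict_bound_gt0[rho rho0 rhoP] _.
exists rho => x rx; apply/eqP; apply: contraTT isT => ux.
have : `|x| < rho by apply: rhoP; exact: subset_closure.
move=> h; exfalso; move: h; rewrite ltNge => /negP; apply.
by rewrite (le_trans (ltW rx))// ler_norm.
Qed.

(** The factor [A] lifts the barrier above 1 on [x <= r0], where the eigenvalue inequality may fail;
    [l >= 0] keeps it there at later times. On [x > r0] the initial datum vanishes and the
    inequality holds. *)
Lemma u_le_exponential p l r phi : 0 < p -> 0 <= l -> test_function phi ->
  (forall x, r < x -> Lop K f (- p) phi x <= l * phi x) ->
  exists2 A, 0 < A & forall t x, 0 <= t -> u t x <= A * expR (l * t - p * x).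
Proof.
move=> p0 l0 /test_function_bounds[cphi [m [Mp [m0 Mp0 phiP]]]] hl.
have aphi y : `|phi y| <= Mp.
  by have /andP[h1 h2] := phiP y; rewrite ger0_norm// (le_trans (ltW m0)).
have [rho rhoP] := u0_support.
pose r0 := Num.max r rho.
pose A := expR (p * r0) / m.
have A0 : 0 < A by rewrite divr_gt0// expR_gt0.
pose v t x := A * expR (l * t - p * x) * phi x.
have phi_ge0 x : 0 <= phi x by have /andP[h _] := phiP x; rewrite (le_trans (ltW m0)).
have v_ge1 t x : 0 <= t -> x <= r0 -> 1 <= v t x.
  move=> t0 xr; have /andP[h _] := phiP x.
  apply: le_trans (_ : A * expR (- (p * r0)) * m <= _).
    by rewrite /A expRN mulrAC divfK ?gt_eqF// mulfV// gt_eqF// expR_gt0.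
  apply: ler_pM => //; [by rewrite mulr_ge0 ?expR_ge0// ltW|exact: ltW|].
  rewrite (ler_pM2l A0) ler_expR -[leLHS]add0r lerB// ?mulr_ge0// ler_wpM2l// ltW//.
have [B B0 BP] := bcoef_bounded hK hM.
have [Aa Aa0 AaP] := acoef_bounded hK hf hM.
have CC : 0 <= Aa + B by rewrite addr_ge0// ltW.
pose w t x := u t x - v t x.
pose dw t x := rhs K f (u t) x - l * v t x.
have v_ge0 t x : 0 <= v t x.
  by apply: mulr_ge0 => //; apply: mulr_ge0; [exact: ltW|exact: expR_ge0].
suff H T t x : 0 <= t <= T -> w t x <= 0.
  exists (A * Mp); first exact: mulr_gt0.
  move=> t x t0; have := H t t x; rewrite t0 lexx => /(_ isT); rewrite /w subr_le0 => /le_trans; apply.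
  rewrite /v mulrAC ler_wpM2r ?expR_ge0// ler_wpM2l ?(ltW A0)//.
  by have /andP[] := phiP x.
have vP s y : is_derive s 1 (v^~ y) (l * v s y).
  have h1 := is_deriveB1 (is_derive_aff l 0 s) (is_derive_cst (p * y) s 1).
  have h2 := is_deriveZ1 (A * phi y) (is_derive_expR1 h1).
  have -> : v^~ y = (fun s => A * phi y * expR (l * (s - 0) - p * y)).
    by apply/funext => s'; rewrite /v !subr0; ring.
  by apply: (is_derive_eq h2); rewrite /v !subr0; ring.
have cmp := @comparison _ w dw 0 T (Aa + B) 1 CC.
apply: cmp.
- move=> y s; apply: cvgB; first exact: (u_continuous_time hu).
  have cv : continuous (v^~ y) by move=> s'; exact: is_derive_continuous (vP s' y).
  exact: continuous_subspaceT cv s.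
- move=> s y /andP[s0 _]; exact: (is_deriveB1 (u_is_derive hu y s0) (vP s y)).
- move=> y; rewrite /w subr_le0; have [yr|ry] := leP y r0.
    by rewrite (le_trans _ (v_ge1 0 y (lexx 0) yr))// (u_le1 hu).
  have -> : u 0 y = 0.
    by case: hu => -> _ _; apply: rhoP; rewrite (le_lt_trans _ ry)// le_max lexx orbT.
  by [].
- by move=> s y /andP[s0 _]; rewrite /w lerBlDr (le_trans (u_le1 hu y s0))// lerDl.
- move=> s N /andP[s0 _] N0 wN y wpos.
  have s_ge0 := ltW s0.
  have ry : r < y.
    rewrite (@le_lt_trans _ _ r0)// ?le_max ?lexx//.
    rewrite ltNge; apply/negP => /(v_ge1 s y s_ge0) h.
    have := u_le1 hu y s_ge0; move: wpos h; rewrite /w; clear_local; lra.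
  have hL := hl y ry; rewrite LopE in hL.
  have iE := Kint_expM hK hM (- p) y cphi aphi.
  have vE : v s = (fun z => A * expR (l * s - p * y) * (expR (- p * (z - y)) * phi z)).
    apply/funext => z; rewrite /v.
    have -> : expR (l * s - p * z) = expR (l * s - p * y) * expR (- p * (z - y)).
      by rewrite -expRD; congr expR; ring.
    ring.
  have iv : Kint K y (v s) by rewrite vE; exact: KintZ.
  have hKu : Kop K (u s) y <= Kop K (v s) y + N * bcoef K y.
    apply: (Kop_u_le hK hu hM s_ge0 iv) => z.
    by have := wN z; rewrite /w; clear_local; lra.
  have hKv : Kop K (v s) y <= (l + acoef K f y) * v s y.
    have E0 : 0 <= A * expR (l * s - p * y) by rewrite mulr_ge0 ?expR_ge0// ltW.
    have -> : (l + acoef K f y) * v s y =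
        A * expR (l * s - p * y) * ((l + acoef K f y) * phi y) by rewrite /v; ring.
    by rewrite vE KopZ// ler_wpM2l//; move: hL; clear_local; lra.
  have hfu := f_leq hf y (u_itv hu y s_ge0).
  have h1 : - acoef K f y * w s y <= Aa * N.
    rewrite (le_trans (ler_norm _))// normrM normrN ler_pM//.
    by rewrite ger0_norm ?(ltW wpos).
  have h2 : N * bcoef K y <= N * B by rewrite ler_wpM2l.
  rewrite /dw /rhs; move: hKu hKv hfu h1 h2; rewrite /w /acoef.
  move: (Kop K (v s) y) (Kop K (u s) y) (f y (u s y)) (bcoef K y) (fs0 f y) (v s y) (u s y).
  clear => Kv Ku fu b f0 V U; lra.
Qed.

Lemma upper_spreading w : cond_K4 K f -> (omega_upper K f < w%:E)%E ->
  ereal_sup [set `|u t x|%:E | x in [set x | w * t <= x]] @[t --> +oo] --> 0%E.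
Proof.
move=> [kpos _] /omega_upper_lt[p [l [r [phi [p0 lw tphi hl]]]]].
have l0 := eigenvalue_gt0 hK hf hM (kpos (- p)) tphi hl.
have [A A0 AP] := u_le_exponential p0 (ltW l0) tphi hl.
apply: cvge0_pinfty => e e0.
pose k := w * p - l.
have k0 : 0 < k by rewrite subr_gt0.
exists (Num.max 0 (k^-1 * (A / e))) => t; rewrite ge_max => /andP[t0 tA].
have Aek : A * expR (- (k * t)) <= e.
  rewrite expRN ler_pdivrMr ?expR_gt0// mulrC -ler_pdivrMr//.
  move: tA; rewrite ler_pdivrMl// => tA.
  by apply: le_trans (expR_ge1Dx _); rewrite (le_trans tA)// lerDr.
apply/andP; split.
  apply: ereal_sup_ge; exists `|u t (w * t)|%:E; last by rewrite lee_fin.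
  by exists (w * t) => /=.
apply: ge_ereal_sup => _ [x /= wx <-]; rewrite lee_fin ger0_norm ?(u_ge0 hu)//.
rewrite (le_trans (AP t x t0))// (le_trans _ Aek)// ler_wpM2l ?(ltW A0)// ler_expR.
have : p * (w * t) <= p * x by rewrite ler_wpM2l// ltW.
by rewrite /k; clear_local; lra.
Qed.

End upper_bound.

Lemma is_derive_exprn (R : realType) (a s : R) n :
  is_derive s 1 (fun t : R => (t - a) ^+ n.+1) (n.+1%:R * (s - a) ^+ n).
Proof.
elim: n => [|n IH].
  have h := is_derive_aff 1 a s.
  rewrite expr0 mulr1; have -> : (fun t : R => (t - a) ^+ 1) = (fun t => 1 * (t - a)).
    by apply/funext => t; rewrite expr1 mul1r.
  exact: h.
have h := is_deriveM1 (is_derive_aff 1 a s) IH.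
have -> : (fun t : R => (t - a) ^+ n.+2) = (fun t => 1 * (t - a) * (t - a) ^+ n.+1).
  by apply/funext => t; rewrite mul1r -exprS.
have n2 : n.+2%:R = n.+1%:R + 1 :> R by rewrite natr1.
by apply: (is_derive_eq h); rewrite n2 exprS; ring.
Qed.

Lemma fact_le_expn n : (n`! <= n ^ n)%N.
Proof.
elim: n => // n IH; rewrite factS expnS leq_mul2l (leq_trans IH) ?orbT//.
by case: n {IH} => // n; rewrite leq_exp2r.
Qed.

(** * A priori lower bounds on the solution *)

Section lower_growth.
Variables (R : realType) (K f : R -> R -> R) (u0 : R -> R) (u : R -> R -> R).
Hypotheses (hK : dispersal_kernel K) (hf : reaction f) (hu : solution K f u0 u).
Hypothesis hM : forall p : R, exists M : R, forall x, (emoment_on K setT p x <= M%:E)%E.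
Implicit Types (a b s t x y z p q c d e m r w l N M A B C P S T W Z rho kappa eta : R).
Implicit Types (phi : R -> R).

(** A differential form of Duhamel's formula: as [f >= 0] and [bcoef K <= B], the time derivative of
    [u] is at least [Kop K u - B * u], and [expR (- B * (s - t0))] is the integrating factor. *)
Lemma duhamel B t0 x (g dg : R -> R) : 0 <= t0 -> 0 <= B -> (forall y, bcoef K y <= B) ->
  (forall s, is_derive s 1 g (dg s)) -> g t0 <= u t0 x ->
  (forall s, t0 < s -> dg s * expR (- B * (s - t0)) <= Kop K (u s) x) ->
  forall s, t0 <= s -> g s * expR (- B * (s - t0)) <= u s x.
Proof.
move=> t0_ge0 B0 BP gP g0 gK s t0s; rewrite -subr_le0.
pose h t := g t * expR (- B * (t - t0)) - u t x.
pose dh t := dg t * expR (- B * (t - t0)) + g t * (- B * expR (- B * (t - t0))) - rhs K f (u t) x.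
have eP t : is_derive t 1 (fun t : R => g t * expR (- B * (t - t0)))
    (dg t * expR (- B * (t - t0)) + g t * (- B * expR (- B * (t - t0)))).
  exact: (is_deriveM1 (gP t) (is_derive_expR1 (is_derive_aff (- B) t0 t))).
apply: (@le0_of_derive_le0 _ h dh t0 s).
- have cv : continuous (fun t : R => g t * expR (- B * (t - t0))).
    by move=> t; exact: is_derive_continuous (eP t).
  move=> t; apply: cvgB; last exact: (u_continuous_time hu).
  exact: continuous_subspaceT cv t.
- move=> t /andP[t0t _]; exact: (is_deriveB1 (eP t) (u_is_derive hu x (le_lt_trans t0_ge0 t0t))).
- by rewrite /h subrr mulr0 expR0 mulr1 subr_le0.
- move=> t /andP[t0t ts] hpos.
  have t_ge0 : 0 <= t by rewrite (le_trans t0_ge0)// ltW.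
  have h1 := gK t t0t.
  have h2 := f_ge0 hf x (u_itv hu x t_ge0).
  have h3 : bcoef K x * u t x <= B * u t x by rewrite ler_wpM2r// (u_ge0 hu).
  have h4 : 0 <= B * h t by rewrite mulr_ge0// ltW.
  move: h1 h2 h3 h4; rewrite /dh /rhs /h.
  move: (expR (- B * (t - t0))) (Kop K (u t) x) (f x (u t x)) (bcoef K x) (u t x) (g t) (dg t).
  by clear => e Ku fu b U G dG h1 h2 h3 h4; lra.
- by rewrite t0s lexx.
Qed.

Lemma u_decay B t0 x : 0 <= t0 -> 0 <= B -> (forall y, bcoef K y <= B) ->
  forall s, t0 <= s -> u t0 x * expR (- B * (s - t0)) <= u s x.
Proof.
move=> t0_ge0 B0 BP; apply: (@duhamel B t0 x (fun=> u t0 x) (fun=> 0)) => //.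
by move=> s t0s; rewrite mul0r Kop_ge0// => y; rewrite (u_ge0 hu)// (le_trans t0_ge0)// ltW.
Qed.

Lemma u_grow B t0 x c n : 0 <= t0 -> 0 <= B -> (forall y, bcoef K y <= B) ->
  (forall s, t0 < s -> c * (s - t0) ^+ n / n`!%:R * expR (- B * (s - t0)) <= Kop K (u s) x) ->
  forall s, t0 <= s ->
  c * (s - t0) ^+ n.+1 / n.+1`!%:R * expR (- B * (s - t0)) <= u s x.
Proof.
move=> t0_ge0 B0 BP H.
apply: (@duhamel B t0 x (fun s => c * (s - t0) ^+ n.+1 / n.+1`!%:R)
  (fun s => c * (s - t0) ^+ n / n`!%:R)) => //.
- move=> s; have h := is_deriveZ1 (c / n.+1`!%:R) (is_derive_exprn t0 s n).
  have -> : (fun s : R => c * (s - t0) ^+ n.+1 / n.+1`!%:R) =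
      (fun s => c / n.+1`!%:R * (s - t0) ^+ n.+1).
    by apply/funext => t; rewrite mulrAC.
  apply: (is_derive_eq h); rewrite factS natrM; field.
  by rewrite pnatr_eq0 -lt0n fact_gt0/= addrC natr1 pnatr_eq0.
- by rewrite subrr expr0n mulr0 mul0r (u_ge0 hu).
Qed.

Hypothesis hu0 : initial_datum u0.
Hypothesis hK1 : forall phi, continuous phi -> (forall x, Kint K x phi) ->
  continuous (Kop K phi).
Hypothesis hK5 : cond_K5 K u0.

Lemma iter_Kop_bounded n : continuous (iter n (Kop K) u0) /\
  exists2 M, 0 <= M & forall x, 0 <= iter n (Kop K) u0 x <= M.
Proof.
elim: n => [|n [cn [M M0 MP]]].
  by case: hu0 => cu u01 _ _; split => //; exists 1.
have in_ x : Kint K x (iter n (Kop K) u0).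
  apply: (@Kint_bounded _ _ hK hM x _ M); first exact: continuous_measurable_fun.
  by move=> y; have /andP[h1 h2] := MP y; rewrite ger0_norm.
split; first exact: hK1.
have [B B0 BP] := bcoef_bounded hK hM.
exists (M * B); first by rewrite mulr_ge0// ltW.
move=> x /=; apply/andP; split.
  by apply: Kop_ge0 => // y; have /andP[] := MP y.
rewrite (le_trans (_ : _ <= Kop K (fun=> M) x))//.
  by apply: Kop_le => //; [exact: Kint_cst|move=> y; have /andP[] := MP y].
by rewrite (Kop_cst hK hM) ler_wpM2l.
Qed.

(** Iterating Duhamel bounds [u] below by every single term of the series in (K5), up to the factor
    [expR (- B * t)]; (K5) forces one of these terms to be positive. *)
Lemma u_gt0 t x : 0 < t -> 0 < u t x.
Proof.
move=> t0; have [B B0 BP] := bcoef_bounded hK hM.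
have low n : forall s y, 0 <= s ->
    iter n (Kop K) u0 y * s ^+ n / n`!%:R * expR (- B * s) <= u s y.
  elim: n => [|n IH] s y s0.
    rewrite /= expr0 mulr1 divr1.
    have := @u_decay B 0 y (lexx 0) (ltW B0) BP s s0.
    by rewrite subr0; case: hu => -> _ _.
  have := @u_grow B 0 y (iter n.+1 (Kop K) u0 y) n (lexx 0) (ltW B0) BP _ s s0.
  rewrite subr0; apply=> r r0; rewrite subr0.
  have [cn [M M0 MP]] := iter_Kop_bounded n.
  have in_ : Kint K y (iter n (Kop K) u0).
    apply: (@Kint_bounded _ _ hK hM y _ M); first exact: continuous_measurable_fun.
    by move=> z; have /andP[h1 h2] := MP z; rewrite ger0_norm.
  have -> : iter n.+1 (Kop K) u0 y * r ^+ n / n`!%:R * expR (- B * r) =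
     Kop K (fun z => r ^+ n / n`!%:R * expR (- B * r) * iter n (Kop K) u0 z) y.
    by rewrite KopZ//=; ring.
  apply: Kop_le => //; [exact: KintZ|exact: (Kint_u hK hu hM _ (ltW r0))|].
  by move=> z; rewrite (le_trans _ (IH r z (ltW r0)))// le_eqVlt; apply/orP; left; apply/eqP; ring.
have [n n0] : exists n, 0 < iter n (Kop K) u0 x.
  apply: contrapT => h; have := hK5 x t0; rewrite eseries0 ?ltxx// => n _ _.
  have [_ [M M0 MP]] := iter_Kop_bounded n; have /andP[h1 _] := MP x.
  have -> : iter n (Kop K) u0 x = 0.
    by apply/eqP; rewrite eq_le h1 andbT leNgt; apply/negP => h2; apply: h; exists n.
  by rewrite mulr0 mul0r.
apply: lt_le_trans (low n t x (ltW t0)).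
by rewrite !mulr_gt0 ?expR_gt0 ?exprn_gt0// invr_gt0 ltr0n fact_gt0.
Qed.

Hypothesis hK3 : cond_K3 K.
Ltac clear_local := clear - hK hf hu hM hu0 hK1 hK5 hK3.

(** The clock starts at time 1, when [u] is positive and so has a positive minimum [e] on
    [[- eta, eta]]. Each use of (K3) widens the interval by [d] on both sides and costs one time
    integration, hence the term of order [n] of an exponential series. *)
Lemma u_lower_itv : exists e d B C eta, [/\ 0 < e <= 1, 0 < d, 0 < B, 0 < C & 0 < eta] /\
  forall n s x, 0 <= s -> `|x| <= eta + n%:R * d ->
    e * (C * s) ^+ n / n`!%:R * expR (- B * s) <= u (1 + s) x.
Proof.
case: hK3 => d [eta [C [d0 eta0 C0 H]]].
have [B B0 BP] := bcoef_bounded hK hM.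
have [c cin cP] : exists2 c, c \in `[- eta, eta] & forall t, t \in `[- eta, eta] -> u 1 c <= u 1 t.
  apply: EVT_min; first by rewrite ge0_cp// ltW.
  by apply: continuous_subspaceT; exact: (u_continuous hu).
have e0 := u_gt0 c ltr01.
exists (u 1 c), d, B, C, eta; split; first by rewrite e0 (u_le1 hu).
elim=> [|n IH] s x s0.
  rewrite mul0r addr0 => xe; rewrite expr0 mulr1 divr1.
  have := @u_decay B 1 x ler01 (ltW B0) BP (1 + s).
  rewrite lerDl addrAC subrr add0r => /(_ s0); apply: le_trans.
  by rewrite ler_wpM2r ?expR_ge0// cP// in_itv/= -ler_norml.
move=> xn.
have G := @u_grow B 1 x (u 1 c * C ^+ n.+1) n ler01 (ltW B0) BP _ (1 + s).
rewrite lerDl [1 + s - 1]addrAC subrr add0r in G.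
rewrite exprMn [u 1 c * _]mulrA; apply: G => // r r1.
pose r' := r - 1; have rE : r = 1 + r' by rewrite /r' addrC subrK.
have r'0 : 0 <= r' by rewrite subr_ge0 ltW.
have r_ge0 : 0 <= r by rewrite (le_trans ler01)// ltW.
have etan : eta <= eta + n%:R * d by rewrite lerDl mulr_ge0// ltW.
have xn' : `|x| <= eta + n%:R * d + d by move: xn; rewrite -natr1 mulrDl mul1r addrA.
have := H _ x (u r) etan xn' (u_continuous hu r_ge0) (fun y => u_ge0 hu y r_ge0).
set I := inf _ => hI.
have hI2 : u 1 c * (C * r') ^+ n / n`!%:R * expR (- B * r') <= I.
  apply: lb_le_inf; first by exists (u r 0), 0 => //=; rewrite normr0 (le_trans (ltW eta0)).
  by move=> _ [y /= yn <-]; rewrite rE; exact: IH.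
apply: le_trans (_ : C * I <= _).
  apply: le_trans (ler_wpM2l (ltW C0) hI2).
  by rewrite le_eqVlt; apply/orP; left; apply/eqP; rewrite exprS exprMn; rewrite -/r'; ring.
apply: (le_trans hI); apply: Kop_le => //; last 2 first.
- exact: (Kint_u hK hu hM).
- by move=> y; rewrite ler_piMr ?cutoff_le1// (u_ge0 hu).
apply: (@Kint_bounded _ _ hK hM x _ 1).
  apply: measurable_funM; first by apply: continuous_measurable_fun; exact: (u_continuous hu).
  have := measurable_cutoff (eta + n%:R * d + d) 0.
  by under eq_fun do rewrite subr0.
move=> y; rewrite ger0_norm ?mulr_ge0 ?cutoff_ge0 ?(u_ge0 hu)//.
by rewrite -[leRHS]mulr1 ler_pM ?cutoff_ge0 ?cutoff_le1 ?(u_ge0 hu) ?(u_le1 hu).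
Qed.

(* (K3) is iterated [n] times with [n] of order [L]; since [n! <= n^n], only a
   factor [expR (- (C * L))] is lost. *)
Lemma u_lower S T : 0 <= S -> exists2 C, 0 < C & forall L t x,
  1 <= L -> 2 * L <= t <= T * L -> `|x| <= S * L -> expR (- (C * L)) <= u t x.
Proof.
move=> S0; have [e [d [B [C [eta [[/andP[e0 e1] d0 B0 C0 eta0] H]]]]]] := u_lower_itv.
pose P := S / d + 1.
have P0 : 0 < P by rewrite ltr_wpDl// divr_ge0// ltW.
(* With [s >= L] and [n <= P * L], each factor [C * s / n] is at least [C / P]. The cap at 1 gives
   [ln k <= 0], so that [k ^+ n] can be bounded below through [n <= P * L]. *)
pose k := Num.min 1 (C / P).
have k0 : 0 < k by rewrite lt_min ltr01 divr_gt0.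
have k1 : k <= 1 by rewrite ge_min lexx.
have lnk : ln k <= 0 by rewrite -ln1 ler_ln ?posrE.
have lne : ln e <= 0 by rewrite -ln1 ler_ln ?posrE.
exists (- ln k * P + B * `|T| + - ln e + 1).
  by rewrite ltr_wpDl// !addr_ge0 ?mulr_ge0 ?oppr_ge0// ltW.
move=> L t x L1 /andP[tL tT] xS.
have L0 : 0 < L by rewrite (lt_le_trans ltr01).
pose s := t - 1; have sL : L <= s by rewrite /s; move: tL L1; clear_local; lra.
have s0 : 0 <= s by rewrite (le_trans (ltW L0)).
have tE : t = 1 + s by rewrite /s addrC subrK.
pose n := (Num.truncn (S * L / d)).+1.
have q0 : 0 <= S * L / d by rewrite divr_ge0 ?mulr_ge0// ltW.
have /andP[n1 n2] := truncn_itv q0.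
have nP : n%:R <= P * L.
  rewrite /n -natr1 /P mulrDl mul1r lerD// (le_trans n1)//.
  by rewrite mulrAC.
have xn : `|x| <= eta + n%:R * d.
  rewrite (le_trans xS)// (le_trans (_ : _ <= n%:R * d)) ?lerDr ?(ltW eta0)//.
  by rewrite -ler_pdivrMr// ltW.
have := H n s x s0 xn; rewrite -tE; apply: le_trans.
have np : (0 : R) < n%:R by rewrite ltr0n.
have h1 : k ^+ n <= (C * s) ^+ n / n`!%:R.
  apply: le_trans (_ : (C * s / n%:R) ^+ n <= _).
    rewrite ler_pXn2r ?nnegrE ?(ltW k0) ?divr_ge0 ?mulr_ge0 ?(ltW C0) ?(ltW np)//.
    rewrite ler_pdivlMr// (le_trans (ler_wpM2l (ltW k0) nP))//.
    rewrite mulrA ler_pM ?mulr_ge0 ?(ltW k0) ?(ltW P0) ?(ltW L0)//.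
    by rewrite -ler_pdivlMr// ge_min lexx orbT.
  rewrite exprMn ler_wpM2l ?exprn_ge0 ?mulr_ge0 ?(ltW C0)//.
  rewrite exprVn lef_pV2 ?posrE ?exprn_gt0// ?ltr0n ?fact_gt0//.
  by rewrite -natrX ler_nat fact_le_expn.
have h2 : expR (ln k * P * L) <= k ^+ n.
  rewrite -{2}(lnK k0) -expRM_natr ler_expR -mulrA.
  by rewrite ler_wnM2l.
have h3 : expR (- (B * `|T| * L)) <= expR (- B * s).
  rewrite ler_expR mulNr lerN2 -mulrA ler_wpM2l ?(ltW B0)//.
  rewrite (le_trans (_ : _ <= t)) ?gerBl// (le_trans tT)// ler_wpM2r ?(ltW L0)//.
  exact: ler_norm.
have h4 : expR (ln e * L) <= e.
  rewrite -{2}(lnK e0) ler_expR -[leRHS]mulr1 ler_wnM2l//.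
apply: le_trans (_ : expR (ln e * L) * expR (ln k * P * L) * expR (- (B * `|T| * L)) <= _).
  by rewrite -!expRD ler_expR; move: L0; clear_local; nra.
rewrite -[e * _ / _]mulrA ler_pM ?mulr_ge0 ?expR_ge0// ler_pM ?expR_ge0//.
exact: le_trans h1.
Qed.

End lower_growth.

(** * Eigenvalue inequalities for the constant test function *)

Section gaps.
Variables (R : realType) (K f : R -> R -> R).
Hypotheses (hK : dispersal_kernel K) (hf : reaction f).
Hypothesis hM : forall p : R, exists M : R, forall x, (emoment_on K setT p x <= M%:E)%E.
Hypothesis hK4 : cond_K4 K f.
Implicit Types (a b s t x y z p q c d e m r w l n N M A B C Q P T W Z rho kappa delta : R).
Implicit Types (g h phi : R -> R).
Ltac clear_local := clear - hK hf hM hK4.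

Lemma expR_dist a b c : `|a| <= c -> `|b| <= c -> `|expR a - expR b| <= `|a - b| * expR c.
Proof.
wlog ab : a b / b <= a => [H ac bc|].
  have [/H|/ltW/H] := leP b a; first exact.
  by rewrite distrC [`|a - b|]distrC; exact.
move=> ac _; rewrite !ger0_norm ?subr_ge0 ?ler_expR//.
have -> : expR a - expR b = expR a * (1 - expR (b - a)).
  by rewrite mulrBr mulr1 -expRD [a + _]addrC subrK.
rewrite mulrC ler_pM ?expR_ge0 ?subr_ge0//.
- by rewrite -expR0 ler_expR subr_le0.
- by have := expR_ge1Dx (b - a); clear_local; lra.
- by rewrite ler_expR (le_trans (ler_norm _)).
Qed.

(** The mean value bound on the exponential produces a factor [|y - x|], absorbed by the moment of
    exponent [Q + 1]. *)
Lemma Kop_expM_dist Q : exists2 M, 0 < M & forall phi P p q x, continuous phi ->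
  (forall y, `|phi y| <= P) -> `|p| <= Q -> `|q| <= Q ->
  `|Kop K (fun y => expR (p * (y - x)) * phi y) x
    - Kop K (fun y => expR (q * (y - x)) * phi y) x| <= P * M * `|p - q|.
Proof.
have [M M0 MP] := Kop_expR_norm_le hK hM (Q + 1); exists M => // phi P p q x cphi phiP pQ qQ.
have P0 : 0 <= P := le_trans (normr_ge0 _) (phiP 0).
have one p1 p2 : `|p1| <= Q -> `|p2| <= Q ->
    Kop K (fun y => expR (p1 * (y - x)) * phi y) x <=
    Kop K (fun y => expR (p2 * (y - x)) * phi y) x + P * M * `|p1 - p2|.
  move=> h1 h2.
  have i2 := Kint_expM hK hM p2 x cphi phiP.
  have i3 := KintZ (P * `|p1 - p2|) (Kint_expR_norm hK hM (Q + 1) x).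
  apply: le_trans (_ : Kop K (fun y => expR (p2 * (y - x)) * phi y
     + P * `|p1 - p2| * expR ((Q + 1) * `|y - x|)) x <= _); last first.
    rewrite KopD// KopZ; last exact: Kint_expR_norm.
    by rewrite lerD2l [leRHS]mulrAC ler_wpM2l// mulr_ge0.
  apply: Kop_le => //; [exact: Kint_expM|exact: KintD|move=> y].
  rewrite -lerBlDl -mulrBl (le_trans (ler_norm _))// normrM mulrC.
  rewrite -mulrA ler_pM//.
  rewrite (le_trans (expR_dist (c := Q * `|y - x|) _ _))//.
  - by rewrite normrM ler_wpM2r.
  - by rewrite normrM ler_wpM2r.
  rewrite -mulrBl normrM -mulrA ler_wpM2l// mulrDl mul1r expRD [leRHS]mulrC.
  by rewrite ler_wpM2r ?expR_ge0// (le_trans _ (expR_ge1Dx _))// lerDr.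
rewrite ler_distl; apply/andP; split; last exact: one.
by rewrite lerBlDr distrC; exact: one.
Qed.

(** The quantity whose lower limit as [|x|] tends to infinity is [kfun K f p] in (K4). *)
Definition gap p x := Lop K f p (fun=> 1) x.

Lemma gapE p x : gap p x = moment K p x - acoef K f x.
Proof.
rewrite /gap LopE momentE// mulr1; congr (Kop _ _ _ - _).
by apply/funext => y; rewrite mulr1.
Qed.

Lemma gap0 x : gap 0 x = fs0 f x.
Proof.
rewrite gapE momentE// /acoef bcoefE.
have -> : (fun y => expR (0 * (y - x))) = (fun=> 1).
  by apply/funext => y; rewrite mul0r expR0.
by rewrite opprB addrC subrK.
Qed.

Lemma gap_dist Q : exists2 M, 0 < M & forall p q x, `|p| <= Q -> `|q| <= Q ->
  `|gap p x - gap q x| <= M * `|p - q|.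
Proof.
have [M M0 MP] := Kop_expM_dist Q; exists M => // p q x pQ qQ.
rewrite /gap !LopE opprB addrA subrK.
have := MP (fun=> 1) 1 p q x (fun y => @cvg_cst _ _ _ _ _) _ pQ qQ.
by rewrite mul1r; apply => y; rewrite normr1.
Qed.

(** For large [|p|] the growth of [k(p) / p] at infinity makes the gap at least [1 / 2]; the
    remaining [p] form a compact interval, on which positivity at each point becomes uniform since
    the gap is Lipschitz in [p]. Only [rho] depends on [p]. *)
Lemma gap_pointwise : exists2 delta, 0 < delta & forall p, exists rho, forall x,
  rho <= `|x| -> delta <= gap p x.
Proof.
have large (g : R -> \bar R) : g p @[p --> +oo] --> +oo%E ->
    exists2 P, 1 <= P & forall p, P <= p -> (1%:E <= g p)%E.
  move=> /cvgeyPge/(_ 1)[T [_ TP]]; exists (Num.max 1 (T + 1)).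
    by rewrite le_max lexx.
  move=> p; rewrite ge_max => /andP[_ Tp]; apply: TP.
  by rewrite (lt_le_trans _ Tp)// ltrDl.
have [kpos [/large[P1 P11 P1P] /large[P2 P21 P2P] _ _]] := hK4.
have half p : (1%:E <= kfun K f p * (`|p|^-1)%:E)%E -> 1 <= `|p| ->
    exists rho, forall x, rho <= `|x| -> 1 / 2 <= gap p x.
  move=> kp p1.
  have p0 : 0 < `|p| by rewrite (lt_le_trans ltr01).
  have [|rho rhoP] := @kfun_gt _ K f (1 / 2) p.
    have : (1%:E <= kfun K f p)%E.
      move: kp; rewrite lee_pdivlMr// mul1e; apply: le_trans.
      by rewrite lee_fin.
    by apply: lt_le_trans; rewrite lte_fin; lra.
  by exists rho => y; rewrite gapE; exact: rhoP.
pose P := Num.max P1 P2.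
have [M M0 MP] := gap_dist (P + 1).
have [q qP|n nP] := @itv_compact_uniform _ (- P) P
  (fun n q => exists rho, forall x, rho <= `|x| -> n^-1 <= gap q x).
  have [k [k0 [rho rhoP]]] := kfun_pos (kpos q).
  exists (Num.min 1 (k / 2 / M)), (k / 2)^-1; split.
    by rewrite lt_min ltr01 !divr_gt0.
  move=> q' n; rewrite lt_min => /andP[q1 qk] kn; exists rho => x xr.
  have qPn : `|q| <= P by rewrite ler_norml.
  have q'P : `|q'| <= P + 1.
    rewrite -(subrK q q') (le_trans (ler_normD _ _))// addrC lerD// ltW//.
  have := MP q' q x q'P; rewrite (le_trans qPn) ?lerDl// => /(_ isT).
  have : M * `|q' - q| <= k / 2 by rewrite mulrC -ler_pdivlMr// ltW.
  have := rhoP x xr; rewrite -gapE.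
  have : n^-1 <= k / 2.
    by rewrite -[leRHS]invrK lef_pV2// posrE ?invr_gt0 ?divr_gt0// (lt_le_trans _ kn)// invr_gt0 divr_gt0.
  rewrite ler_norml; move: (gap q' x) (gap q x) (M * _) => G1 G2 G3.
  by clear_local => h1 h2 h3 /andP[h5 h6]; lra.
pose i := Num.max n 2.
have i2 : 2 <= i by rewrite le_max lexx orbT.
have i0 : 0 < i by rewrite (lt_le_trans _ i2).
exists i^-1; first by rewrite invr_gt0.
move=> p; have [pP|] := boolP (`|p| <= P).
  have [rho rhoP] : exists rho, forall x, rho <= `|x| -> i^-1 <= gap p x.
    by apply: nP; [rewrite le_max lexx|rewrite -ler_norml].
  by exists rho.
rewrite -ltNge => Pp.
have ih : i^-1 <= 1 / 2 by rewrite div1r lef_pV2 ?posrE.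
have P1P' : P1 <= `|p| by rewrite (le_trans _ (ltW Pp))// le_max lexx.
have P2P' : P2 <= `|p| by rewrite (le_trans _ (ltW Pp))// le_max lexx orbT.
have p1 : 1 <= `|p| by rewrite (le_trans P11).
have [|rho rhoP] := half p _ p1.
  have [p0|p0] := leP 0 p.
    by rewrite -{1}(ger0_norm p0); exact: P1P.
  have pE : - `|p| = p by rewrite ltr0_norm// opprK.
  by rewrite -{1}pE; exact: P2P.
by exists rho => x /rhoP; exact: le_trans.
Qed.

(** The quantifier order matters: [delta] precedes [Q], only [rho] follows it. For small slopes no
    restriction on [x] is needed, because the gap at slope 0 is [fs0 f], which has a positive lower
    bound on the whole line. *)
Lemma gap_uniform : exists delta q1, [/\ 0 < delta, 0 < q1,
  forall p x, `|p| <= q1 -> delta <= gap p x &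
  forall Q, exists rho, forall p x, `|p| <= Q -> rho <= `|x| -> delta <= gap p x].
Proof.
have [d d0 dP] := gap_pointwise.
have [c c0 cP] := fs0_inf hf.
pose delta := Num.min (d / 2) (c / 2).
have delta0 : 0 < delta by rewrite lt_min !divr_gt0.
have [M1 M10 M1P] := gap_dist 1.
exists delta, (Num.min 1 (c / 2 / M1)); split=> //.
- by rewrite lt_min ltr01 !divr_gt0.
- move=> p x; rewrite le_min => /andP[p1 pc].
  have := M1P p 0 x p1; rewrite normr0 ler01 subr0 gap0 => /(_ isT).
  have : M1 * `|p| <= c / 2 by rewrite mulrC -ler_pdivlMr.
  rewrite ge_min ler_norml; have := cP x.
  move: (gap p x) (fs0 f x) (M1 * _) => G1 G2 G3; clear_local => h1 h2 /andP[h3 _].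
  by apply/orP; right; lra.
move=> Q; have [M M0 MP] := gap_dist (Q + 1).
have [q qQ|n nP] := @itv_compact_uniform _ (- Q) Q
  (fun n q => forall x, n <= `|x| -> delta <= gap q x).
  have [rho rhoP] := dP q.
  exists (Num.min 1 (d / 2 / M)), rho; split.
    by rewrite lt_min ltr01 !divr_gt0.
  move=> q' n; rewrite lt_min => /andP[q1 qk] kn x xr.
  have qPn : `|q| <= Q by rewrite ler_norml.
  have q'P : `|q'| <= Q + 1.
    rewrite -(subrK q q') (le_trans (ler_normD _ _))// addrC lerD// ltW//.
  have := MP q' q x q'P; rewrite (le_trans qPn) ?lerDl// => /(_ isT).
  have : M * `|q' - q| <= d / 2 by rewrite mulrC -ler_pdivlMr// ltW.
  have := rhoP x (le_trans kn xr).
  rewrite ge_min ler_norml; move: (gap q' x) (gap q x) (M * _) => G1 G2 G3; clear_local => h1 h2 /andP[h3 _].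
  by apply/orP; left; lra.
by exists n => p x pQ nx; apply: (nP n p (lexx n)) => //; rewrite -ler_norml.
Qed.

End gaps.

(** * The squared positive part, from which the profiles are built *)

Section pospart_square.
Variable R : realType.
Implicit Types (x y z d : R).

Definition pospart x : R := Num.max 0 x.

Lemma pospart_ge0 x : 0 <= pospart x.
Proof. by rewrite /pospart le_max lexx. Qed.

Lemma pospart_ge x : x <= pospart x.
Proof. by rewrite /pospart le_max lexx orbT. Qed.

Lemma pospart_eq0 x : x <= 0 -> pospart x = 0.
Proof. by move=> x0; rewrite /pospart max_l. Qed.

Lemma pospart_le x y : 0 <= y -> x <= y -> pospart x <= y.
Proof. by move=> y0 xy; rewrite /pospart ge_max y0. Qed.

(** A negative multiple of this square is concave and lies above its tangents up to a quadratic
    error, as [propagation_bound] requires of a profile. *)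
Lemma pospart_sqrD z d :
  pospart (z + d) ^+ 2 <= pospart z ^+ 2 + 2 * pospart z * d + d ^+ 2.
Proof.
have -> : pospart z ^+ 2 + 2 * pospart z * d + d ^+ 2 = (pospart z + d) ^+ 2 by ring.
have [zd|zd] := leP (z + d) 0; first by rewrite pospart_eq0// expr0n sqr_ge0.
have zd2 : z + d <= pospart z + d by rewrite lerD2r pospart_ge.
have z1 : 0 <= pospart z + d := le_trans (ltW zd) zd2.
by rewrite {1}/pospart max_r ?(ltW zd)// ler_pXn2r ?nnegrE ?(ltW zd).
Qed.

End pospart_square.

(** * Invasion at some positive speed *)

Section linear_invasion.
Variables (R : realType) (K f : R -> R -> R) (u0 : R -> R) (u : R -> R -> R).
Hypotheses (hK : dispersal_kernel K) (hf : reaction f) (hu : solution K f u0 u).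
Hypothesis hM : forall p : R, exists M : R, forall x, (emoment_on K setT p x <= M%:E)%E.
Hypothesis hu0 : initial_datum u0.
Hypothesis hK1 : forall phi : R -> R, continuous phi -> (forall x, Kint K x phi) ->
  continuous (Kop K phi).
Hypotheses (hK3 : cond_K3 K) (hK4 : cond_K4 K f) (hK5 : cond_K5 K u0).
Implicit Types (a b s t x y z p q c d e m r w l N M A B C Q P T W Z L H S : R).
Implicit Types (phi : R -> R).
Ltac clear_local := clear - hK hf hu hM hu0 hK1 hK3 hK4 hK5.

(* On the scale [L], a profile flat on [|x| <= L] rises at the rate [delta / 2]
   from the level guaranteed by [u_lower], while its edges at [|x| = 2 L] stay
   below that level. *)
Lemma linear_invasion : exists e c T, [/\ 0 < e, 0 < c &
  forall t x, T <= t -> `|x| <= c * t -> e <= u t x].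
Proof.
have [delta [q1 [delta0 q10 gap_near gap_far]]] := gap_uniform hK hf hM hK4.
have d20 : 0 < delta / 2 by rewrite divr_gt0.
have d80 : 0 < delta / 2 / 4 by rewrite divr_gt0.
have [e /andP[e0 e1] eP] := f_ge_linear hf d80.
have three : (0 : R) <= 3 by [].
have [H H0 HP] := u_lower hK hf hu hM hu0 hK1 hK5 hK3 2 three.
(* Between the times [2 * L] and [T * L] a rise at the rate [delta / 2] makes up exactly for the
   initial depth [H * L]. *)
pose T := 2 + H / (delta / 2).
have T2 : 2 < T by rewrite /T ltrDl divr_gt0.
have [A A0 AP] := u_lower hK hf hu hM hu0 hK1 hK5 hK3 T three.
have Q0 : 0 < 2 * A by rewrite mulr_gt0.
have [rho rhoP] := gap_far (2 * A).
have [r [eta [r0 eta0 prop]]] := propagation_bound hK hf hu hM (2 * A) d20 (lexx 0).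
pose Ls := Num.max 1 (Num.max (2 * r) (Num.max (r + rho) (2 * A / eta))).
suff main L : Ls <= L -> forall x, `|x| <= L -> e * expR (- 2) <= u (T * L) x.
  have T0 : 0 < T by rewrite (lt_trans _ T2).
  exists (e * expR (- 2)), T^-1, (T * Ls); split.
  - by rewrite mulr_gt0// expR_gt0.
  - by rewrite invr_gt0.
  move=> t x Tt xt.
  have -> : t = T * (T^-1 * t) by rewrite mulrA divff ?mul1r// gt_eqF.
  by apply: main => //; rewrite ler_pdivlMl.
rewrite !ge_max => /and4P[L1 Lr Lrho LA].
have L0 : 0 < L by rewrite (lt_le_trans ltr01).
have AL0 : 0 < A / L by rewrite divr_gt0.
pose G x := pospart (x - L) ^+ 2 + pospart (- x - L) ^+ 2.
(* The constant 2 is the margin [2 * C + 2] with [C = 0]. The amplitude [A / L] makes the profile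
   drop by [A * L] between [|x| = L] and [|x| = 2 * L], with slopes of size at most [2 * A]. *)
pose chi t x := ln e - 2 - H * L + delta / 2 * (t - 2 * L) - A / L * G x.
pose sig (_ : R) x := - (2 * (A / L) * (pospart (x - L) - pospart (- x - L))).
pose D t x := [/\ 2 * L < t, t <= T * L & `|x| < 2 * L].
have G0 x : 0 <= G x by rewrite addr_ge0// sqr_ge0.
have Gfar x : 2 * L <= `|x| -> L ^+ 2 <= G x.
  move=> xL.
  have key y : 2 * L <= y -> L ^+ 2 <= pospart (y - L) ^+ 2.
    move=> yL; rewrite ler_pXn2r ?nnegrE ?pospart_ge0 ?(ltW L0)//.
    by apply: le_trans (pospart_ge _); move: yL; clear_local; lra.
  have [x0|x0] := leP 0 x.
    by rewrite (le_trans (key x _)) ?lerDl ?sqr_ge0//; rewrite ger0_norm in xL.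
  by rewrite (le_trans (key (- x) _)) ?lerDr ?sqr_ge0//; rewrite ltr0_norm in xL.
have TH : delta / 2 * (T * L - 2 * L) = H * L.
  by rewrite /T; field; rewrite gt_eqF.
have chi_le t x : t <= T * L -> chi t x + 2 <= ln e - A / L * G x.
  move=> tT; have : delta / 2 * (t - 2 * L) <= H * L.
    by rewrite -TH ler_wpM2l ?(ltW d20)// lerD2r.
  by rewrite /chi; clear_local; lra.
have lne : ln e <= 0 by rewrite -ln1 ler_ln ?posrE.
have chi_edge t x : t <= T * L -> 2 * L <= `|x| -> chi t x + 2 <= - (A * L).
  move=> tT xL; apply: le_trans (chi_le t x tT) _.
  have : A / L * L ^+ 2 <= A / L * G x by rewrite ler_wpM2l ?(ltW AL0)// Gfar.
  have -> : A / L * L ^+ 2 = A * L by field; rewrite gt_eqF.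
  by move: lne; clear_local; lra.
have inZ x : - (3 * L) <= x <= 3 * L -> `|x| <= 3 * L by rewrite -ler_norml.
have sig_le t x : D t x -> `|sig t x| <= 2 * A.
  move=> [_ _ xL].
  rewrite /sig normrN normrM ger0_norm; last by rewrite mulr_ge0// ltW.
  rewrite -ler_pdivlMl; last by rewrite mulr_gt0.
  have -> : (2 * (A / L))^-1 * (2 * A) = L by field; rewrite !gt_eqF.
  move: xL; rewrite ltr_norml => /andP[xl xr].
  have p1 : pospart (x - L) <= L by apply: pospart_le; [exact: ltW|move: xr; clear_local; lra].
  have p2 : pospart (- x - L) <= L by apply: pospart_le; [exact: ltW|move: xl; clear_local; lra].
  have := pospart_ge0 (x - L); have := pospart_ge0 (- x - L).
  rewrite ler_norml; move: p1 p2; move: (pospart _) (pospart _).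
  by clear_local => P1 P2 h1 h2 h3 h4; apply/andP; split; lra.
have := prop e (2 * L) (T * L) (- (3 * L)) (3 * L) (expR (- (A * L))) D chi
  (fun _ _ => delta / 2) sig; rewrite !mulr0 !add0r => main.
have u_chi t x : D t x -> expR (chi t x) <= u t x.
  apply: main => {t x}.
  - by rewrite mulr_ge0// ltW.
  - exact: expR_gt0.
  - exact: eP.
  - move=> t0 x0 t x Dt0 _.
    have h1 := pospart_sqrD (x0 - L) (x - x0).
    have h2 := pospart_sqrD (- x0 - L) (x0 - x).
    rewrite (_ : x0 - L + (x - x0) = x - L) in h1; last by ring.
    rewrite (_ : - x0 - L + (x0 - x) = - x - L) in h2; last by ring.
    have h3 : A / L * G x <= A / L * (G x0 + 2 * (pospart (x0 - L) - pospart (- x0 - L)) * (x - x0)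
        + 2 * (x - x0) ^+ 2).
      rewrite ler_wpM2l ?(ltW AL0)// /G; move: h1 h2.
      move: (pospart (x - L)) (pospart (- x - L)) (pospart (x0 - L)) (pospart (- x0 - L)).
      by clear_local => P1 P2 P3 P4; rewrite !expr2; lra.
    have h4 : A / L * 2 * (x - x0) ^+ 2 <= eta * (x - x0) ^+ 2.
      rewrite ler_wpM2r ?sqr_ge0// -mulrAC ler_pdivrMr// mulrC -ler_pdivrMl//.
      by rewrite [eta^-1 * _]mulrC; exact: LA.
    have h5 : 0 <= eta * (t - t0) ^+ 2 by rewrite mulr_ge0 ?sqr_ge0// ltW.
    rewrite /chi /sig; move: h3 h4 h5.
    move: (G x) (G x0) (A / L) (pospart (x0 - L)) (pospart (- x0 - L)).
    by clear_local => G1 G2 B P1 P2; rewrite !expr2; lra.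
  - move=> t x [tL tT xL]; split=> //.
      move: xL Lr; rewrite ltr_norml; clear_local => /andP[h1 h2] h3.
      apply/andP; split; lra.
    exact: sig_le.
  - move=> t x /andP[_ tT]; rewrite -[leRHS](lnK e0) ler_expR (le_trans (chi_le t x tT))//.
    by rewrite gerBl mulr_ge0// ltW.
  - move=> t x tt /inZ xZ; exact: AP.
  - move=> t x /andP[tL tT] /inZ xZ nD.
    move: tL; rewrite le_eqVlt => /orP[/eqP tE|tL].
      apply: le_trans (HP L t x L1 _ xZ); last by rewrite -tE lexx.
      rewrite ler_expR /chi -tE subrr mulr0 addr0.
      have : 0 <= A / L * G x by rewrite mulr_ge0// ltW.
      by move: lne; clear_local; lra.
    apply: le_trans (AP L t x L1 _ xZ); last by rewrite (ltW tL).
    rewrite ler_expR; apply: chi_edge => //.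
    by rewrite leNgt; apply/negP => xL; apply: nD.
  - move=> t0 x0 [t0L t0T x0L]; exists (fun=> 1); split.
    + by move=> y; exact: cvg_cst.
    + by move=> y; rewrite oppr0 expR0 lexx.
    move=> t x _ xr; rewrite mulr1 -splitr.
    (* Slopes up to [q1] are admissible everywhere. Larger ones occur only for
       [|x0| > L >= r + rho], hence at points whose whole box lies in the range of [gap_far]. *)
    have [sq|sq] := leP `|sig t0 x0| q1; first exact: gap_near.
    apply: rhoP; first exact: sig_le.
    have x0L' : L < `|x0|.
      rewrite ltNge; apply/negP; rewrite ler_norml => /andP[h1 h2].
      move: sq; rewrite /sig !pospart_eq0 ?subrr ?mulr0 ?oppr0 ?normr0.
      + by rewrite ltNge (ltW q10).
      + by move: h1; clear_local; lra.
      + by rewrite subr_le0.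
    have := ler_distD x x0 0; rewrite !subr0 distrC.
    by move: xr x0L' Lrho; clear_local; lra.
move=> x xL; have xL2 : `|x| < 2 * L by move: xL L0; clear_local; lra.
have Dx : D (T * L) x by split=> //; rewrite ltr_pM2r.
apply: le_trans (u_chi _ _ Dx).
rewrite -{1}(lnK e0) -expRD ler_expR /chi TH.
have -> : G x = 0.
  move: xL; rewrite ler_norml => /andP[h1 h2].
  rewrite /G !pospart_eq0 ?expr0n ?addr0//.
  + by move: h1; clear_local; lra.
  + by rewrite subr_le0.
by rewrite mulr0; clear_local; lra.
Qed.

End linear_invasion.

(** * Eigenvalue inequalities uniform over bounded slopes *)

Section eigen_uniform.
Variables (R : realType) (K f : R -> R -> R).
Hypotheses (hK : dispersal_kernel K) (hf : reaction f).
Hypothesis hM : forall p : R, exists M : R, forall x, (emoment_on K setT p x <= M%:E)%E.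
Implicit Types (a b s t x y z p q c d e m r w l n N M A B C Q P T W Z : R).
Implicit Types (phi : R -> R).
Ltac clear_local := clear - hK hf hM.

(** [omega_lower] only concerns positive slopes; at slope 0 the constant test function works, thanks
    to the positive lower bound on [fs0 f]. *)
Lemma positive_gap w q : 0 <= q -> (w%:E < omega_lower K f)%E ->
  exists l r phi m M, [/\ w * q < l, 0 < m, continuous phi,
    (forall x, m <= phi x <= M) &
    forall x, r < x -> l * phi x <= Lop K f (- q) phi x].
Proof.
rewrite le_eqVlt => /orP[/eqP <-|q0] wo.
  have [c c0 cP] := fs0_inf hf.
  exists c, 0, (fun=> 1), 1, 1; split; rewrite ?mulr0//.
  - by move=> x; exact: cvg_cst.
  - by move=> x; rewrite lexx.
  - by move=> x _; rewrite mulr1 oppr0 -/(gap K f 0 x) gap0.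
have [l [r [phi [wl tphi hl]]]] := omega_lower_gt q0 wo.
have [cphi [m [M [m0 M0 mM]]]] := test_function_bounds tphi.
by exists l, r, phi, m, M.
Qed.

(** The test function found for one slope serves for all nearby slopes, since [Kop] depends on the
    exponent in a Lipschitz way; compactness then leaves one [n] for the gap, the bounds on [phi]
    and the half-line. *)
Lemma eigen_uniform w Q : 0 <= w -> (w%:E < omega_lower K f)%E ->
  exists2 n, 1 <= n & forall q, 0 <= q <= Q -> exists phi, [/\ continuous phi,
    (forall y, n^-1 <= phi y <= n) &
    forall x, n <= x -> (w * q + n^-1) * phi x <= Lop K f (- q) phi x].
Proof.
move=> w0 wo; have [M M0 MP] := Kop_expM_dist hK hM (Q + 1).
have [q /andP[q0 qQ]|n nP] := @itv_compact_uniform _ 0 Q (fun n q => exists phi, [/\ continuous phi,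
    (forall y, n^-1 <= phi y <= n) &
    forall x, n <= x -> (w * q + n^-1) * phi x <= Lop K f (- q) phi x]).
  have [l [r [phi [m [P [wl m0 cphi phiP hl]]]]]] := positive_gap q0 wo.
  have P0 : 0 < P by have /andP[h1 h2] := phiP 0; exact: lt_le_trans m0 (le_trans h1 h2).
  have aphi y : `|phi y| <= P.
    by have /andP[h1 h2] := phiP y; rewrite ger0_norm// (le_trans (ltW m0)).
  pose g := l - w * q; have g0 : 0 < g by rewrite subr_gt0.
  pose k := P * M / m + w + 1.
  have PMm : 0 < P * M / m by rewrite divr_gt0// mulr_gt0.
  have k0 : 0 < k by rewrite ltr_wpDl// addr_ge0// ltW.
  (* Moving the slope by [d] costs [P * M / m * d] in the operator and [w * d] in the target,
     together at most half of the gap [g]; the other half bounds [n^-1]. *)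
  pose d := g / 2 / k; have d0 : 0 < d by rewrite !divr_gt0.
  exists (Num.min 1 d), (Num.max (g / 2)^-1 (Num.max P (Num.max m^-1 (r + 1)))); split.
    by rewrite lt_min ltr01.
  move=> q' n; rewrite lt_min !ge_max => /andP[q1 qd] /and4P[ng nP nm nr].
  have n0 : 0 < n by rewrite (lt_le_trans P0).
  have inv_le c : 0 < c -> c^-1 <= n -> n^-1 <= c.
    move=> c0 cn; rewrite -[leRHS]invrK lef_pV2// posrE ?invr_gt0//.
  exists phi; split=> //.
    move=> y; have /andP[h1 h2] := phiP y.
    by rewrite (le_trans _ h1) ?inv_le//= (le_trans h2).
  move=> x nx; have rx : r < x by rewrite (lt_le_trans _ (le_trans nr nx))// ltrDl.
  have := hl x rx; rewrite !LopE => hlx.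
  have /andP[h1 h2] := phiP x.
  have qn : `|- q| <= Q + 1 by rewrite normrN ger0_norm// (le_trans qQ)// lerDl.
  have qn' : `|- q'| <= Q + 1.
    rewrite normrN -(subrK q q') (le_trans (ler_normD _ _))// addrC lerD// ?(ltW q1)//.
    by rewrite ger0_norm.
  have := MP phi P (- q) (- q') x cphi aphi qn qn'.
  rewrite (_ : - q - - q' = q' - q); last by ring.
  move=> dist.
  have h3 : P * M * `|q' - q| <= P * M / m * d * phi x.
    have PM0 : 0 <= P * M by rewrite mulr_ge0// ltW.
    apply: le_trans (_ : P * M * d <= _); first by rewrite ler_wpM2l// ltW.
    have -> : P * M / m * d * phi x = P * M * d * (phi x / m) by ring.
    rewrite -[leLHS]mulr1 ler_wpM2l//; first by rewrite mulr_ge0// ltW.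
    by rewrite ler_pdivlMr// mul1r.
  have h4 : w * q' <= w * q + w * d.
    rewrite -mulrDr ler_wpM2l// -lerBlDl (le_trans (ler_norm _))// ltW//.
  have h5 : n^-1 <= g / 2 by apply: inv_le => //; rewrite divr_gt0.
  have kd : (P * M / m + w) * d <= g / 2.
    have : k * d = g / 2 by rewrite /d mulrC divfK// gt_eqF.
    by rewrite /k; move: d0; clear_local; lra.
  have h6 : (w * q' + n^-1 + P * M / m * d) * phi x <= l * phi x.
    rewrite ler_wpM2r ?(le_trans (ltW m0))//.
    by move: h4 h5 kd; rewrite /g; clear_local; lra.
  move: dist; rewrite ler_norml => /andP[_ dist].
  move: dist hlx h3 h6; move: (Kop K _ x) (Kop K _ x) (acoef K f x).
  by clear_local => K1 K2 A dist h1 h2 h3; lra.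
exists (Num.max 1 n); first by rewrite le_max lexx.
by move=> q qQ; apply: nP => //; rewrite le_max lexx orbT.
Qed.

End eigen_uniform.

(** * Invasion at every speed below [omega_lower] *)

Section front_invasion.
Variables (R : realType) (K f : R -> R -> R) (u0 : R -> R) (u : R -> R -> R).
Hypotheses (hK : dispersal_kernel K) (hf : reaction f) (hu : solution K f u0 u).
Hypothesis hM : forall p : R, exists M : R, forall x, (emoment_on K setT p x <= M%:E)%E.
Hypothesis hu0 : initial_datum u0.
Hypothesis hK1 : forall phi : R -> R, continuous phi -> (forall x, Kint K x phi) ->
  continuous (Kop K phi).
Hypotheses (hK3 : cond_K3 K) (hK4 : cond_K4 K f) (hK5 : cond_K5 K u0).
Implicit Types (a b s t x y z p q c d e m r w l n N M A B C Q P T W Z L H S : R).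
Implicit Types (phi : R -> R).
Ltac clear_local := clear - hK hf hu hM hu0 hK1 hK3 hK4 hK5.

(* On the scale [L], a front with logarithmic slopes in [- Q, 0], flat on its
   left, travels at the speed [w]. *)
Lemma front_step w e c T k N : 0 <= w -> (w%:E < omega_lower K f)%E ->
  0 < e <= 1 -> 0 < c -> (forall t x, T <= t -> `|x| <= c * t -> e <= u t x) ->
  2 <= k -> 3 <= c * k -> k < N ->
  exists e' Ls, 0 < e' <= e /\ forall L, Ls <= L -> forall x,
     2 * L < x <= L + w * ((N - k) * L) -> e' <= u (N * L) x.
Proof.
move=> w0 wo /andP[e0 e1] c0 eP k2 ck kN.
(* The front stays left of [L + w * N * L], its descent takes one more [L], and the last [L] leaves
   room for boxes of half-width [2 * r]. *)
pose S := w * N + 3.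
have N0 : 0 < N by rewrite (le_lt_trans _ kN)// (le_trans _ k2).
have S0 : 0 <= S by rewrite addr_ge0// mulr_ge0// ltW.
have [A A0 AP] := u_lower hK hf hu hM hu0 hK1 hK5 hK3 N S0.
have Q0 : 0 < 2 * A by rewrite mulr_gt0.
have [n n1 nP] := eigen_uniform hK hf hM (2 * A) w0 wo.
have n0 : 0 < n by rewrite (lt_le_trans ltr01).
pose C := ln n.
have C0 : 0 <= C by rewrite /C -ln1 ler_ln ?posrE.
have nV0 : 0 < n^-1 by rewrite invr_gt0.
have nV40 : 0 < n^-1 / 4 by rewrite divr_gt0.
have [b /andP[b0 b1] bP] := f_ge_linear hf nV40.
have [r [eta [r0 eta0 prop]]] := propagation_bound hK hf hu hM (2 * A) nV0 C0.
pose eB := Num.min e b.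
have eB0 : 0 < eB by rewrite lt_min e0.
have eBe : eB <= e by rewrite ge_min lexx.
have eBb : eB <= b by rewrite ge_min lexx orbT.
have lneB : ln eB <= 0 by rewrite -ln1 ler_ln ?posrE// (le_trans eBe).
pose e' := eB * expR (- (2 * C + 2)).
exists e', (Num.max 1 (Num.max (2 * r) (Num.max n (Num.max T (A * (2 * (1 + w ^+ 2)) / eta))))).
split.
  apply/andP; split; first by rewrite mulr_gt0// expR_gt0.
  rewrite (le_trans _ eBe)// ler_piMr ?(ltW eB0)// -expR0 ler_expR oppr_le0.
  by rewrite addr_ge0// mulr_ge0.
move=> L; rewrite !ge_max => /and5P[L1 Lr Ln LT LA] x /andP[xL xX].
have L0 : 0 < L by rewrite (lt_le_trans ltr01).
have AL0 : 0 < A / L by rewrite divr_gt0.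
(* The descent occupies [[X t, X t + L]]. At the initial time [k * L] it ends at [2 * L], within the
   zone already covered by the linear invasion, so [u] is above the whole profile. *)
pose X t := L + w * (t - k * L).
pose z t x := pospart (x - X t).
pose chi t x := ln eB - (2 * C + 2) - A / L * z t x ^+ 2.
pose q t x := 2 * (A / L) * z t x.
pose D t x := [/\ k * L < t, t <= N * L & 2 * L < x < X t + L].
have z0 t y : 0 <= z t y by exact: pospart_ge0.
have chi_le t y : chi t y + (2 * C + 2) <= ln eB.
  have : 0 <= A / L * z t y ^+ 2 by rewrite mulr_ge0 ?sqr_ge0// ltW.
  by rewrite /chi; clear_local; lra.
have chi_edge t y : X t + L <= y -> chi t y + (2 * C + 2) <= - (A * L).
  move=> yX.
  have h1 : L ^+ 2 <= z t y ^+ 2.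
    rewrite ler_pXn2r ?nnegrE ?z0 ?(ltW L0)//.
    apply: le_trans (pospart_ge _).
    by move: yX; clear_local; lra.
  have : A / L * L ^+ 2 <= A / L * z t y ^+ 2 by rewrite ler_wpM2l ?(ltW AL0).
  have -> : A / L * L ^+ 2 = A * L by field; rewrite gt_eqF.
  by move: lneB; rewrite /chi; clear_local; lra.
have q_itv t y : D t y -> 0 <= q t y <= 2 * A.
  move=> [_ _ /andP[_ yX]]; apply/andP; split.
    by apply: mulr_ge0 => //; rewrite mulr_ge0// ltW.
  rewrite /q -ler_pdivlMl; last by rewrite mulr_gt0.
  have -> : (2 * (A / L))^-1 * (2 * A) = L by field; rewrite !gt_eqF.
  by apply: pospart_le; [exact: ltW|move: yX; clear_local; lra].
have XN t : k * L <= t -> t <= N * L -> X t <= L + w * N * L.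
  move=> kt tN; rewrite /X lerD2l -mulrA ler_wpM2l//.
  have : 0 <= k * L by rewrite mulr_ge0 ?(ltW L0)// (le_trans _ k2).
  by move: tN; clear_local; lra.
have near_u t y : k * L <= t -> `|y| <= 3 * L -> e <= u t y.
  move=> kt y3; apply: eP.
    rewrite (le_trans LT)// (le_trans _ kt)// ler_peMl ?(ltW L0)//.
    by rewrite (le_trans _ k2)// ler1n.
  rewrite (le_trans y3)// (le_trans (_ : _ <= c * (k * L))) ?ler_wpM2l ?(ltW c0)//.
  by rewrite mulrA ler_wpM2r// ltW.
(* The profile is a function of [x - w * t], so its time derivative is [w] times the opposite of its
   slope [- q]. *)
have := prop b (k * L) (N * L) L (S * L) (expR (- (A * L))) D chi
  (fun t x => w * q t x) (fun t x => - q t x) => main.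
have xD : D (N * L) x.
  split; [by rewrite ltr_pM2r|exact: lexx|rewrite xL/=].
  by rewrite (le_lt_trans xX)// /X -mulrBl ltrDl.
have -> : e' = expR (chi (N * L) x).
  rewrite /chi /z pospart_eq0 ?expr0n ?mulr0 ?subr0 ?expRD ?lnK//.
  by rewrite subr_le0 /X -mulrBl.
apply: main xD => {x xL xX}.
- by rewrite mulr_ge0 ?(ltW L0)// (le_trans _ k2).
- exact: expR_gt0.
- exact: bP.
- move=> t0 x0 t x _ _.
  have h1 := pospart_sqrD (x0 - X t0) (x - x0 - w * (t - t0)).
  rewrite (_ : x0 - X t0 + (x - x0 - w * (t - t0)) = x - X t) in h1; last by rewrite /X; ring.
  have h2 : (x - x0 - w * (t - t0)) ^+ 2 <= 2 * (1 + w ^+ 2) * ((x - x0) ^+ 2 + (t - t0) ^+ 2).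
    have : 0 <= (x - x0 + w * (t - t0)) ^+ 2 by rewrite sqr_ge0.
    have : 0 <= (t - t0) ^+ 2 by rewrite sqr_ge0.
    have : 0 <= w ^+ 2 * (x - x0) ^+ 2 by rewrite mulr_ge0 ?sqr_ge0.
    by clear_local; rewrite !expr2; lra.
  have h3 : A / L * (2 * (1 + w ^+ 2)) * ((x - x0) ^+ 2 + (t - t0) ^+ 2)
      <= eta * ((x - x0) ^+ 2 + (t - t0) ^+ 2).
    rewrite ler_wpM2r ?addr_ge0 ?sqr_ge0// mulrAC ler_pdivrMr//.
    by move: LA; rewrite ler_pdivrMr// [L * eta]mulrC.
  have h4 : A / L * z t x ^+ 2 <= A / L * (z t0 x0 ^+ 2 + 2 * z t0 x0 * (x - x0 - w * (t - t0))
      + 2 * (1 + w ^+ 2) * ((x - x0) ^+ 2 + (t - t0) ^+ 2)).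
    rewrite ler_wpM2l ?(ltW AL0)// (le_trans h1)// lerD2l//.
  rewrite /chi /q; move: h3 h4; move: (z t x ^+ 2) (z t0 x0) (A / L).
  by clear_local => Z1 Z2 B; rewrite !expr2; lra.
- move=> t x Dtx; have := q_itv t x Dtx; case: Dtx => kt tN /andP[xL xX] /andP[q1 q2].
  split=> //; last by rewrite normrN ger0_norm.
  have := XN t (ltW kt) tN; move: Lr xL xX; rewrite /S.
  by clear_local => h1 h2 h3 h4; apply/andP; split; lra.
- by move=> t x _; rewrite (le_trans _ eBb)// -[leRHS](lnK eB0) ler_expR.
- move=> t x /andP[kt tN] /andP[Lx xS]; apply: AP => //.
    by rewrite tN andbT (le_trans _ kt)// ler_wpM2r// ltW.
  by rewrite ger0_norm// (le_trans (ltW L0)).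
- move=> t x /andP[kt tN] /andP[Lx xS] nD.
  have x0 : 0 <= x by rewrite (le_trans (ltW L0)).
  have [x3|x3] := leP x (2 * L).
    rewrite (le_trans _ (near_u t x kt _))//.
      by rewrite (le_trans _ eBe)// -[leRHS](lnK eB0) ler_expR.
    by rewrite ger0_norm// (le_trans x3)// ler_wpM2r ?(ltW L0)// ler_nat.
  have xX : X t + L <= x.
    rewrite leNgt; apply/negP => xX; apply: nD; split=> //; last by rewrite x3.
    rewrite lt_neqAle kt andbT; apply/eqP => ktE.
    move: xX; rewrite /X -ktE subrr mulr0 addr0 ltNge => /negP; apply.
    by move: x3; clear_local; lra.
  apply: le_trans (AP L t x L1 _ _).
  + by rewrite ler_expR; exact: chi_edge.
  + by rewrite tN andbT (le_trans _ kt)// ler_wpM2r// ltW.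
  + by rewrite ger0_norm.
- move=> t0 x0 Dtx0; have [phi [cphi phiP hphi]] := nP _ (q_itv _ _ Dtx0).
  exists phi; split=> //.
    by move=> y; rewrite expRN /C lnK.
  move=> t x [_ _ /andP[xL _]] _; apply: hphi.
  by rewrite (le_trans Ln)// (le_trans _ (ltW xL))// ler_peMl ?(ltW L0)// ler1n.
Qed.

Lemma front_invasion w : 0 <= w -> (w%:E < omega_lower K f)%E ->
  exists e c w' T, [/\ 0 < e, 0 < c, w < w' &
    forall t x, T <= t -> - (c * t) <= x <= w' * t -> e <= u t x].
Proof.
move=> w0 wo.
have [w1 ww1 w1o] : exists2 w1, w < w1 & (w1%:E < omega_lower K f)%E.
  case: (omega_lower K f) wo => [v|_|//].
    by rewrite lte_fin => wo; exists ((w + v) / 2); rewrite ?lte_fin; lra.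
  by exists (w + 1); rewrite ?ltry// ltrDl.
have w10 : 0 < w1 by exact: le_lt_trans ww1.
have [e1 [c [T [e10 c0 eP]]]] := linear_invasion hK hf hu hM hu0 hK1 hK3 hK4 hK5.
pose e := Num.min e1 1.
have e0 : 0 < e <= 1 by rewrite lt_min e10 ltr01 ge_min lexx orbT.
have eP' t x : T <= t -> `|x| <= c * t -> e <= u t x.
  by move=> Tt xt; rewrite (le_trans _ (eP t x Tt xt))// ge_min lexx.
pose k := Num.max 2 (3 / c).
have k2 : 2 <= k by rewrite le_max lexx.
have ck : 3 <= c * k by rewrite -ler_pdivrMl// mulrC le_max lexx orbT.
pose w2 := (w + w1) / 2.
(* The front starts only at time [k * L]; [N] is large enough for the speed [w1] to make up for this
   delay, that is [w2 * N <= w1 * (N - k)]. *)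
pose N := w1 * k / (w1 - w2) + k.
have d0 : 0 < w1 - w2 by rewrite /w2; move: ww1; clear_local; lra.
have k0 : 0 < k by rewrite (lt_le_trans _ k2).
have kN : k < N by rewrite /N ltrDr divr_gt0// mulr_gt0.
have N0 : 0 < N by rewrite (lt_trans k0).
have [e' [Ls [/andP[e'0 e'e] main]]] := front_step (ltW w10) w1o e0 c0 eP' k2 ck kN.
exists e', c, w2, (Num.max (Num.max T 0) (N * Ls)); split=> //.
  by rewrite /w2; move: ww1; clear_local; lra.
move=> t x; rewrite !ge_max => /andP[/andP[Tt t0] Nt] /andP[xc xw].
have [xct|xct] := leP x (c * t).
  by rewrite (le_trans e'e)// eP'// ler_norml xc.
pose L := N^-1 * t.
have tE : t = N * L by rewrite /L mulrA divff ?mul1r// gt_eqF.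
have LsL : Ls <= L by rewrite /L ler_pdivlMl.
have L0 : 0 <= L by rewrite /L mulr_ge0// invr_ge0 ltW.
rewrite tE; apply: main => //; apply/andP; split.
  have cN : 2 <= c * N.
    by rewrite (le_trans _ (ler_wpM2l (ltW c0) (ltW kN)))// (le_trans _ ck)// ler_nat.
  have : 0 <= (c * N - 2) * L by rewrite mulr_ge0// subr_ge0.
  by move: xct; rewrite tE; clear_local; lra.
rewrite (le_trans xw)// tE.
have h1 : w1 * k <= (w1 - w2) * N.
  have -> : (w1 - w2) * N = w1 * k + (w1 - w2) * k by rewrite /N; field; rewrite gt_eqF.
  by rewrite lerDl mulr_ge0// ltW.
have : 0 <= ((w1 - w2) * N - w1 * k) * L by rewrite mulr_ge0// subr_ge0.
by move: L0; clear_local; lra.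
Qed.

End front_invasion.

(** * Convergence to 1 behind the front *)

Section saturation.
Variables (R : realType) (K f : R -> R -> R) (u0 : R -> R) (u : R -> R -> R).
Hypotheses (hK : dispersal_kernel K) (hf : reaction f) (hu : solution K f u0 u).
Hypothesis hM : forall p : R, exists M : R, forall x, (emoment_on K setT p x <= M%:E)%E.
Implicit Types (a b s t x y z p q c d e m r w l n N M A B C Q P T W Z L beta zeta : R).
Implicit Types (phi : R -> R).
Ltac clear_local := clear - hK hf hu hM.

Lemma cap_lipschitz beta x y z : 0 <= beta ->
  Num.min (beta * `|z - x|) 1 <= Num.min (beta * `|y - x|) 1 + beta * `|z - y|.
Proof.
move=> b0; rewrite -lerBlDr le_min !lerBlDr; apply/andP; split.
  rewrite (le_trans (_ : _ <= beta * `|z - x|)) ?ge_min ?lexx//.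
  by rewrite -mulrDr ler_wpM2l// [leRHS]addrC ler_distD.
by rewrite ge_min lerDl mulr_ge0// orbT.
Qed.

(* A cone of small slope [beta] rising at the rate [c / 2], where [c] bounds
   the reaction from below, is a subsolution. *)
Lemma saturation e c1 w' T w d : 0 < e -> 0 < c1 -> 0 <= w -> w < w' -> 0 < d ->
  (forall t x, T <= t -> - (c1 * t) <= x <= w' * t -> e <= u t x) ->
  exists T', forall t x, T' <= t -> 0 <= x <= w * t -> 1 - d <= u t x.
Proof.
(* Together with the bound on [e] below, this gives [e < 1 - d], so that the rising time [T1] is
   positive. *)
wlog d4 : d / d <= 1 / 4 => [H|].
  move=> e0 c10 w0 ww' d0 he.
  have [||T' T'P] := H (Num.min d (1 / 4)) _ e0 c10 w0 ww' _ he.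
  - by rewrite ge_min lexx orbT.
  - by rewrite lt_min d0 divr_gt0.
  exists T' => t x Tt xw; apply: le_trans (T'P t x Tt xw).
  by rewrite lerD2l lerN2 ge_min lexx.
wlog e2 : e / e <= 1 / 2 => [H|].
  move=> e0 c10 w0 ww' d0 he.
  apply: (H (Num.min e (1 / 2))) => //.
  - by rewrite ge_min lexx orbT.
  - by rewrite lt_min e0 divr_gt0.
  - by move=> t x Tt xw; rewrite (le_trans _ (he t x Tt xw))// ge_min lexx.
move=> e0 c10 w0 ww' d0 he.
have d1 : 1 - d < 1 by rewrite gtrBl.
have [c c0 cP] := f_inf_itv hf e0 d1.
have [B B0 BP] := bcoef_bounded hK hM.
have [M M0 MP] := Kop_expR_norm_le hK hM 1.
(* The slope costs at most [beta * M = c / 2] in the nonlocal term, and the other half of [c] is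
   left for the rise. *)
pose beta := c / 2 / M; have beta0 : 0 < beta by rewrite !divr_gt0.
have bM : beta * M = c / 2 by rewrite /beta divfK// gt_eqF.
have c20 : 0 < c / 2 by rewrite divr_gt0.
pose T1 := (1 - d - e) / (c / 2).
have T10 : 0 < T1.
  by rewrite divr_gt0//; move: d4 e2; clear_local; lra.
have T1E : c / 2 * T1 = 1 - d - e by rewrite /T1 mulrC divfK// gt_eqF.
have dw0 : 0 < w' - w by rewrite subr_gt0.
have w'0 : 0 < w' by exact: le_lt_trans ww'.
(* During the rise, from [t - T1] to [t], the base of the cone, of radius [beta^-1], must stay in
   the invaded zone: the second bound handles its left end, the third its right end, using
   [w < w']. *)
exists (Num.max (T1 + Num.max 0 T) (Num.max (T1 + (c1 * beta)^-1) ((w' * T1 + beta^-1) / (w' - w)))).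
move=> t x0; rewrite !ge_max => /and3P[tT tc tw] /andP[x00 x0w].
pose s0 := t - T1.
have s0t : s0 <= t by rewrite gerBl ltW.
have /andP[s00 s0T] : (0 <= s0) && (T <= s0).
  by rewrite -ge_max lerBrDr addrC.
have s0c : (c1 * beta)^-1 <= s0 by rewrite lerBrDr addrC.
have known s y : s0 <= s <= t -> beta * `|y - x0| <= 1 -> e <= u s y.
  move=> /andP[s0s st] yx; apply: he; first exact: le_trans s0s.
  have yx' : `|y - x0| <= beta^-1 by rewrite -[leRHS]mulr1 ler_pdivlMl.
  have h1 : beta^-1 <= c1 * s.
    rewrite -ler_pdivrMl// -invfM; exact: le_trans s0s.
  have h2 : w' * T1 + beta^-1 <= (w' - w) * t.
    by move: tw; rewrite ler_pdivrMr// [t * _]mulrC.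
  have h3 : w' * (t - T1) <= w' * s by rewrite ler_wpM2l// ltW.
  move: yx'; rewrite ler_norml => /andP[h4 h5]; apply/andP; split.
    by move: h1 h4 x00; clear_local; lra.
  by move: h2 h3 h5 x0w; clear_local; lra.
(* Truncating at depth 1 keeps the cone bounded, hence integrable; where the cap equals 1 the cone
   is at most [- d], below [u >= 0]. *)
pose cap y := Num.min (beta * `|y - x0|) 1.
have cap0 y : 0 <= cap y by rewrite le_min ler01 mulr_ge0// ltW.
have cap1 y : cap y <= 1 by rewrite ge_min lexx orbT.
have mcap : measurable_fun [set: R] cap.
  apply: measurable_minr => //; apply: continuous_measurable_fun => y.
  by apply: cvgM; [exact: cvg_cst|apply: cvg_norm; apply: cvgB; [exact: cvg_id|exact: cvg_cst]].
pose zeta s := e + c / 2 * (s - s0).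
have zeta_le s : s <= t -> zeta s <= 1 - d.
  move=> st; have : c / 2 * (s - s0) <= c / 2 * T1.
    by rewrite ler_wpM2l ?(ltW c20)// /s0; move: st; clear_local; lra.
  by rewrite T1E /zeta; clear_local; lra.
pose v s y := zeta s - cap y.
pose W s y := v s y - u s y.
pose dW s y := c / 2 - rhs K f (u s) y.
have near_x0 s y : s0 <= s <= t -> 0 < W s y -> beta * `|y - x0| <= 1.
  move=> /andP[s0s st] Wpos; rewrite leNgt; apply/negP => yx.
  have capE : cap y = 1 by rewrite /cap min_r// ltW.
  have := u_ge0 hu y (le_trans s00 s0s); have := zeta_le s st.
  by move: Wpos; rewrite /W /v capE; move: d0; clear_local; lra.
have capx0 : cap x0 = 0 by rewrite /cap subrr normr0 mulr0 min_l.
suff : W t x0 <= 0.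
  have zt : zeta t = 1 - d by rewrite /zeta /s0 (_ : t - (t - T1) = T1) ?T1E; ring.
  by rewrite /W /v capx0 subr0 zt subr_le0.
have cmp := @comparison _ W dW s0 t B 1 (ltW B0).
apply: cmp; last by rewrite s0t lexx.
- move=> y s; apply: cvgB; last exact: (u_continuous_time hu).
  apply: cvgB; last exact: cvg_cst.
  apply: cvgD; first exact: cvg_cst.
  have cz : continuous (fun s => c / 2 * (s - s0)).
    by move=> s'; exact: is_derive_continuous (is_derive_aff _ _ _).
  exact: continuous_subspaceT cz s.
- move=> s y /andP[s0s st].
  have h1 := is_deriveD1 (is_derive_cst (e - cap y) s 1) (is_derive_aff (c / 2) s0 s).
  have h2 := is_deriveB1 h1 (u_is_derive hu y (le_lt_trans s00 s0s)).
  have -> : W^~ y = (fun s => e - cap y + c / 2 * (s - s0) - u s y).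
    by apply/funext => s'; rewrite /W /v /zeta; ring.
  by apply: (is_derive_eq h2); rewrite /dW add0r.
- move=> y; rewrite leNgt; apply/negP => Wpos.
  have ss : s0 <= s0 <= t by rewrite lexx s0t.
  have := known s0 y ss (near_x0 s0 y ss Wpos).
  move: Wpos (cap0 y); rewrite /W /v /zeta subrr mulr0 addr0.
  by clear_local; lra.
- move=> s y /andP[s0s st]; have := u_ge0 hu y (le_trans s00 s0s).
  have := zeta_le s st; have := cap0 y; rewrite /W /v; move: d0.
  by clear_local; lra.
- move=> s N /andP[s0s st] N0 WN y Wpos.
  have ss : s0 <= s <= t by rewrite !ltW.
  have s_ge0 : 0 <= s by rewrite (le_trans s00)// ltW.
  have uy := known s y ss (near_x0 s y ss Wpos).
  have iv : Kint K y (v s).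
    apply: (@Kint_bounded _ _ hK hM y _ (`|zeta s| + 1)).
      by apply: measurable_funB => //; exact: measurable_cst.
    move=> z; rewrite (le_trans (ler_normB _ _))// lerD2l ger0_norm//.
  have hKu : Kop K (v s) y - N * bcoef K y <= Kop K (u s) y.
    apply: (Kop_u_ge hK hu hM s_ge0 iv) => z.
    by have := WN z; rewrite /W; clear_local; lra.
  have hKv : v s y * bcoef K y - c / 2 <= Kop K (v s) y.
    have i1 := Kint_cst hK hM y (v s y).
    have i2 := KintZ (- beta) (Kint_expR_norm hK hM 1 y).
    apply: le_trans (Kop_le hK (KintD i1 i2) iv _).
      rewrite KopD// (Kop_cst hK hM) KopZ; last exact: Kint_expR_norm.
      by rewrite lerD2l mulNr lerN2 -bM ler_wpM2l ?(ltW beta0).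
    move=> z; rewrite /v -addrA lerD2l mulNr -opprD lerN2.
    rewrite (le_trans (cap_lipschitz x0 y z (ltW beta0)))// lerD2l mul1r.
    rewrite ler_wpM2l ?(ltW beta0)// (le_trans _ (expR_ge1Dx _))// lerDr//.
  have hfu : c <= f y (u s y).
    apply: cP; rewrite uy/=; have := zeta_le s (ltW st); have := cap0 y.
    by move: Wpos; rewrite /W /v; clear_local; lra.
  have h1 : N * bcoef K y <= B * N by rewrite mulrC ler_wpM2r.
  have h2 : 0 <= bcoef K y * W s y by rewrite mulr_ge0 ?bcoef_ge0// ltW.
  rewrite /dW /rhs; move: hKu hKv hfu h1 h2; rewrite /W.
  move: (Kop K (v s) y) (Kop K (u s) y) (f y (u s y)) (bcoef K y) (v s y) (u s y).
  by clear_local => Kv Ku fu b V U h1 h2 h3 h4 h5; lra.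
Qed.

End saturation.

(** * Lower bound on the spreading speed *)

Section lower_spreading.
Variables (R : realType) (K f : R -> R -> R) (u0 : R -> R) (u : R -> R -> R).
Hypotheses (hK : dispersal_kernel K) (hf : reaction f) (hu : solution K f u0 u).
Hypothesis hM : forall p : R, exists M : R, forall x, (emoment_on K setT p x <= M%:E)%E.
Hypothesis hu0 : initial_datum u0.
Hypothesis hK1 : forall phi : R -> R, continuous phi -> (forall x, Kint K x phi) ->
  continuous (Kop K phi).
Hypotheses (hK3 : cond_K3 K) (hK4 : cond_K4 K f) (hK5 : cond_K5 K u0).
Ltac clear_local := clear - hK hf hu hM hu0 hK1 hK3 hK4 hK5.

Lemma lower_spreading (w : R) : 0 <= w -> (w%:E < omega_lower K f)%E ->
  ereal_sup [set `|u t x - 1|%:E | x in [set x | 0 <= x <= w * t]]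
    @[t --> +oo] --> 0%E.
Proof.
move=> w0 wo.
have [e [c [w' [T [e0 c0 ww' he]]]]] := front_invasion hK hf hu hM hu0 hK1 hK3 hK4 hK5 w0 wo.
apply: cvge0_pinfty => d d0.
have [T' T'P] := saturation hK hf hu hM e0 c0 w0 ww' d0 he.
exists (Num.max 0 T') => t; rewrite ge_max => /andP[t0 Tt]; apply/andP; split.
  apply: ereal_sup_ge; exists `|u t 0 - 1|%:E; last by rewrite lee_fin.
  by exists 0 => //=; rewrite lexx mulr_ge0.
apply: ge_ereal_sup => _ [x /= xw <-]; rewrite lee_fin ler_norml.
have := T'P t x Tt xw; have := u_le1 hu x t0; move: d0.
by clear_local => h1 h2 h3; apply/andP; split; lra.
Qed.

End lower_spreading.

Theorem theorem2p1 (R : realType) (K f : R -> R -> R) (u0 : R -> R)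
    (u : R -> R -> R)
    (hK : dispersal_kernel K) (hu0 : initial_datum u0) (hf : reaction f)
    (hu : solution K f u0 u) :
  (cond_K1 K -> cond_K4 K f ->
   forall w : R, (omega_upper K f < w%:E)%E ->
     ereal_sup [set `|u t x|%:E | x in [set x | w * t <= x]]
       @[t --> +oo] --> 0%E) /\
  (cond_K1 K -> cond_K2 K -> cond_K3 K -> cond_K4 K f -> cond_K5 K u0 ->
   forall w : R, 0 <= w -> (w%:E < omega_lower K f)%E ->
     ereal_sup [set `|u t x - 1|%:E | x in [set x | 0 <= x <= w * t]]
       @[t --> +oo] --> 0%E).
Proof.
have hM : cond_K1 K -> forall p : R, exists M : R, forall x, (emoment_on K setT p x <= M%:E)%E.
  by move=> [_ h] p; have [] := h p.
split=> [/hM hM1 hK4 w wo|hK1 _ hK3 hK4 hK5 w w0 wo].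
  exact: (upper_spreading hK hf hu hu0 hM1 hK4 wo).
exact: (lower_spreading hK hf hu (hM hK1) hu0 (hK1.1) hK3 hK4 hK5 w0 wo).
Qed.
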